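(* Let $f:(\mathbb{C}^2,0)\to(\mathbb{C},0)$ be a holomorphic function germ, mini-regular in $x$, and let $\mathcal{C}=\mathcal{GC}(\gamma_* )$ be a gradient canyon of degree $d=d_{\mathcal{C}}$. If $\gamma_1,\gamma_2$ are polar arcs contained in $\mathcal{C}$, then $$\widehat{\mathcal{NP}}(f_x,\gamma_1)=\widehat{\mathcal{NP}}(f_x,\gamma_2).$$ In particular, $\widehat{\mathcal{NP}}(f_x,\gamma)$ depends only on the canyon $\mathcal{C}$.
   Context: **Arcs.** $\mathbb{F}$ is the field of convergent fractional power series (Puiseux series) in $y$ over $\mathbb{C}$; $\operatorname{ord}$ is the order in $y$; $\mathbb{F}_1=\{\eta\in\mathbb{F}:\operatorname{ord}\eta\ge1\}$. For $\eta=\sum a_iy^{n_i/N}\in\mathbb{F}_1$ with $N$ minimal, $\eta_*$ denotes the curve germ that is the image of $t\mapsto(\eta(t^N),t^N)$; the $N$ conjugates of $\eta$ define the same $\eta_*$. A germ $f$ with $m=\operatorname{ord}_0f$ is mini-regular in $x$ if its initial form $f_m$ satisfies $f_m(1,0)\ne0$. A polar arc of $f$ is $\gamma\in\mathbb{F}_1$ with $f_x(\gamma(y),y)\equiv0$ and $f(\gamma(y),y)\not\equiv0$; put $h(\gamma)=\operatorname{ord}f(\gamma(y),y)$. **Canyons.** The gradient degree $d(\gamma)\in\mathbb{Q}$ of a polar arc $\gamma$ is the smallest $q$ such that $\operatorname{ord}\|\operatorname{grad}f(\gamma(y),y)\|=\operatorname{ord}\|\operatorname{grad}f(\gamma(y)+uy^q,y)\|$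 for generic $u\in\mathbb{C}$. The gradient canyon $\mathcal{GC}(\gamma_* )$ is the set of curve germs $\alpha_*$ with $\alpha=\gamma+uy^{d(\gamma)}+\text{h.o.t.}$, $u\in\mathbb{C}$. A polar arc $\alpha$ is contained in $\mathcal{C}$ if $\alpha_*\in\mathcal{C}$. All polar arcs in a canyon $\mathcal{C}$ have the same gradient degree $d_{\mathcal{C}}$ (the degree of $\mathcal{C}$) and the same order $h(\gamma)$ (known facts). **Augmented Newton polygon.** For a (possibly fractional in $Y$) series $G(X,Y)=\sum c_{ij}X^iY^j$, $\mathcal{NP}(G)$ is the boundary of the convex hull of $\{(i+u,j+v):c_{ij}\neq0,\ u,v\ge0\}$. $\mathcal{NP}(f_x,\gamma)$ is the Newton polygon of $f_x(X+\gamma(Y),Y)$, and $\widehat{\mathcal{NP}}(f_x,\gamma)=\operatorname{Conv}\bigl(\mathcal{NP}(f_x,\gamma)\cup\{(0,h(\gamma)-1)\}\bigr)\subset\mathbb{R}^2$.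
   Formalization: When d = 1 it is assumed that all polar arcs in the canyon have gradient degree 1; without this the claim fails, e.g. for f = x^3 - x^2 y + y^5 with the polar arcs 2y/3 and 0. For d > 1 nothing is added. *)

(* Defs.v *)
From HB Require Import structures.
From mathcomp Require Import all_boot all_order all_algebra.
From mathcomp Require Import complex.
From mathcomp Require Import all_classical all_reals all_analysis.

Set Implicit Arguments.
Unset Strict Implicit.
Unset Printing Implicit Defensive.

Import Order.TTheory GRing.Theory Num.Theory.
Import numFieldNormedType.Exports.

Local Open Scope classical_set_scope.
Local Open Scope ring_scope.
Local Open Scope complex_scope.

Section Series.
Variable R : realType.

(* A germ (C^2,0) -> C is given by its Taylor coefficients: [f i j] is the
   coefficient of x^i y^j. *)
Definition series2 := nat -> nat -> R[i].

(* Absolute convergence on some polydisc. For z : R[i], [0 < z] says that z is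
   a positive real number. *)
Definition convergent2 (f : series2) :=
  exists r M : R[i], 0 < r /\
    forall n, \sum_(i < n) \sum_(j < n) `|f i j| * r ^+ (i + j) <= M.

Definition holomorphic_germ (f : series2) := convergent2 f /\ f 0%N 0%N = 0.

Definition dx (f : series2) : series2 := fun i j => i.+1%:R * f i.+1 j.
Definition dy (f : series2) : series2 := fun i j => j.+1%:R * f i j.+1.

Definition has_order (f : series2) (m : nat) :=
  (forall i j, (i + j < m)%N -> f i j = 0) /\
  (exists i j, (i + j = m)%N /\ f i j <> 0).

Definition initial_form (f : series2) (m : nat) (x y : R[i]) : R[i] :=
  \sum_(i < m.+1) f i (m - i)%N * x ^+ i * y ^+ (m - i).

Definition mini_regular (f : series2) :=
  exists m, has_order f m /\ initial_form f m 1 0 <> 0.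

(* A series in fractional powers of y: [a q] is the coefficient of y^q. *)
Definition fseries := rat -> R[i].

Definition supported_in (a : fseries) (N : nat) :=
  forall q, a q <> 0 -> q * N%:R \is a Num.int.

Definition puiseux (a : fseries) :=
  exists N : nat, [/\ (0 < N)%N,
    supported_in a N,
    exists b : rat, forall q, a q <> 0 -> b <= q
    & exists r M : R[i], 0 < r /\
        forall n, \sum_(k < n) `|a (k%:R / N%:R)| * r ^+ k <= M].

Definition ord (a : fseries) : \bar R :=
  ereal_inf [set (ratr q)%:E | q in [set q | a q <> 0]].

Definition F1 (a : fseries) := puiseux a /\ (1%:E <= ord a)%E.

Definition fone : fseries := fun q => (q == 0)%:R.
Definition fmono (u : R[i]) (p : rat) : fseries :=
  fun q => if q == p then u else 0.
Definition fadd (a b : fseries) : fseries := fun q => a q + b q.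
(* For Puiseux series, only finitely many terms of this sum are nonzero. *)
Definition fmul (a b : fseries) : fseries :=
  fun q => \sum_(p \in [set: rat]) a p * b (q - p).
Definition fexp (a : fseries) (n : nat) : fseries := iter n (fmul a) fone.

(* [translate g a i q] is the coefficient of X^i Y^q in g(X + a(Y), Y), after
   expanding each (X + a(Y))^k by the binomial formula. For a Puiseux series a
   of positive order, only finitely many terms of this sum are nonzero. *)
Definition translate (g : series2) (a : fseries) : nat -> fseries := fun i q =>
  \sum_(kj \in [set: nat * nat])
     g kj.1 kj.2 * 'C(kj.1, i)%:R * fexp a (kj.1 - i) (q - kj.2%:R).

(* g(a(y), y) *)
Definition subst (g : series2) (a : fseries) : fseries := fun q =>
  \sum_(kj \in [set: nat * nat]) g kj.1 kj.2 * fexp a kj.1 (q - kj.2%:R).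

Definition polar_arc (f : series2) (g : fseries) :=
  [/\ F1 g, forall q, subst (dx f) g q = 0 & exists q, subst f g q <> 0].

Definition h (f : series2) (g : fseries) : \bar R := ord (subst f g).

(* The order of the norm of a vector of series is the least order of its
   components. *)
Definition ord_grad (f : series2) (a : fseries) : \bar R :=
  Order.min (ord (subst (dx f) a)) (ord (subst (dy f) a)).

(* Generic u: all but finitely many u. The condition 0 < q makes the
   substitution of g + u y^q into f meaningful. *)
Definition grad_stable (f : series2) (g : fseries) (q : rat) :=
  0 < q /\ finite_set [set u : R[i] |
    ord_grad f (fadd g (fmono u q)) <> ord_grad f g].

Definition gradient_degree (f : series2) (g : fseries) (d : rat) :=
  grad_stable f g d /\ forall q, grad_stable f g q -> d <= q.

(* The image of t |-> (a(t^N), t^N) on its domain of convergence, N being the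
   minimal common denominator of the exponents of a in F1. *)
Definition is_ramification (a : fseries) (N : nat) :=
  [/\ (0 < N)%N, supported_in a N
    & forall M : nat, (0 < M)%N -> supported_in a M -> (N <= M)%N].

Definition arc_image (a : fseries) : set (R[i]^o * R[i]^o) :=
  [set p | exists (N : nat) (t : R[i]), [/\ is_ramification a N,
     series (fun k : nat => (a (k%:R / N%:R) * t ^+ k : R[i]^o)) @ \oo --> p.1
     & p.2 = t ^+ N]].

(* The germ at the origin of a subset of C^2, as an equivalence class. *)
Definition set_germ := set (set (R[i]^o * R[i]^o)).

Definition germ_at0 (A : set (R[i]^o * R[i]^o)) : set_germ :=
  [set B | \forall p \near nbhs ((0, 0) : R[i]^o * R[i]^o), A p <-> B p].

Definition curve_germ (a : fseries) : set_germ := germ_at0 (arc_image a).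

(* The set of a_* with a = g + u y^d + higher order terms, d = d(g). *)
Definition gradient_canyon (f : series2) (g : fseries) : set set_germ :=
  [set S | exists (a : fseries) (u : R[i]) (d : rat),
     [/\ gradient_degree f g d, F1 a,
         forall q, q <= d -> a q = fadd g (fmono u d) q
       & S = curve_germ a]].

Definition contained_in (a : fseries) (C : set set_germ) := C (curve_germ a).

(* The property defining the degree d of a canyon C: its polar arcs all have
   gradient degree d. For C = gradient_canyon f g, it follows from
   [gradient_degree f g d] when d > 1, but it may fail when d = 1: if
   f = x^3 - x^2 y + y^5, the polar arc g = 2y/3 has gradient degree 1, and its
   canyon contains the polar arc 0, which has gradient degree 3. *)
Definition common_degree (f : series2) (C : set set_germ) (d : rat) :=
  forall a, polar_arc f a -> contained_in a C -> gradient_degree f a d.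

Definition convex_hull (A : set (R * R)) : set (R * R) :=
  \bigcap_(K in [set K : set (R * R) |
     @convex_set R (R^o * R^o)%type K /\ A `<=` K]) K.

Definition boundary (A : set (R * R)) : set (R * R) :=
  closure A `\` interior A.

Definition newton_polygon (G : nat -> fseries) : set (R * R) :=
  boundary (convex_hull [set p : R * R | exists (i : nat) (j : rat) (u v : R),
    [/\ G i j <> 0, 0 <= u, 0 <= v & p = (i%:R + u, ratr j + v)]]).

Definition NP (g : series2) (a : fseries) : set (R * R) :=
  newton_polygon (translate g a).

(* \hat{NP}(f_x, g); h(g) is finite when g is a polar arc. *)
Definition NP_hat (f : series2) (g : fseries) : set (R * R) :=
  convex_hull (NP (dx f) g `|` [set (0, fine (h f g) - 1)]).

End Series.

(* Main.v *)
(* Write G_i for the coefficient of X^i in f_x(X + g(Y), Y), g a polar arc, so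
   that G_0 = 0. By the chain rule ord f_y(g) = h(g) - 1, and for d >= 1 the
   order of grad f is the same along g and g + u y^d for generic u only if
   ord G_i + d i >= h(g) - 1 for all i; taking i = m - 1, where ord G_i = 0 by
   mini-regularity, this inequality also gives d >= 1, with h(g) = m if d = 1.
   If g' = g + (terms of order >= d) is another polar arc, the Taylor expansion
   of f at g gives h(g') = h(g) when d > 1, and that of f_x shows that the corners
   of the polygon of g' lie above segments joining (0, h(g) - 1) to that of g.
   Finally, polar arcs of the canyon are only given up to the equality of their
   curve germs: by the identity theorem for power series, such arcs are
   conjugate, and conjugation does not change the supports of the series. *)
Require Import Defs.
From mathcomp Require Import all_boot all_order all_algebra.
From mathcomp Require Import complex.
From mathcomp Require Import all_classical all_reals all_analysis.
From mathcomp Require Import ring lra zify.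

Set Implicit Arguments.
Unset Strict Implicit.
Unset Printing Implicit Defensive.

Import Order.TTheory GRing.Theory Num.Theory.
Import numFieldNormedType.Exports.

Local Open Scope classical_set_scope.
Local Open Scope ring_scope.
Local Open Scope complex_scope.

(** * Formal fractional power series *)

(** All arcs compared have their exponents in one lattice (1/K)N, with K serving two arcs and the
    degree d at once, and have no constant term. A coefficient of a substituted series then depends
    on finitely many coefficients, so the Taylor formula and the chain rule become identities
    between truncated polynomials in t = y^(1/K). A Newton polygon is defined as a boundary, whereas
    the corner argument compares full regions. The region lies in the convex hull of its boundary,
    and closedness keeps that boundary inside the region. There may be infinitely many corners; row
    m - 1, which reaches height 0, reduces them to finitely many. The bound ord G_i + d i >= h(g) -
    1 passes from g to g', so both inclusions between hulls come from stability of the gradient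
    order at g alone. The value of h is what may change when d = 1: the perturbation can then cancel
    the leading term of f along g, and h = m is obtained from the degree of each arc. *)

Lemma sum_neq0 (I : finType) (V : nmodType) (F : I -> V) :
  \sum_i F i != 0 -> exists i, F i != 0.
Proof.
apply: contra_neqP => /forallNP F0.
by apply: big1 => i _; apply/eqP/negP => /negP; exact: F0.
Qed.

Lemma fsum_seq (T : choiceType) (V : nmodType) (F : T -> V) (s : seq T) :
  uniq s -> (forall x, F x != 0 -> x \in s) ->
  \sum_(x \in [set: T]) F x = \sum_(x <- s) F x.
Proof.
move=> us Fs; rewrite (fsbigE s) //; last first.
  by move=> x _; apply: contraNeq => /Fs.
by apply: eq_bigl => x; rewrite in_setT.
Qed.

Lemma fsum_neq0 (T : choiceType) (V : nmodType) (F : T -> V) :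
  \sum_(x \in [set: T]) F x != 0 -> exists x, F x != 0.
Proof.
apply: contra_neqP => /forallNP F0.
by apply: fsbig1 => x _; apply/eqP/negP => /negP; exact: F0.
Qed.

Lemma coef_comp_polyDX (S : comNzRingType) (p : {poly S}) (c : S) (i N : nat) :
  (size p <= N)%N ->
  (p \Po ('X + c%:P))`_i = \sum_(k < N) p`_k * c ^+ (k - i) *+ 'C(k, i).
Proof.
move=> pN; rewrite comp_polyE coef_sum (big_ord_widen N (fun k =>
  (p`_k *: ('X + c%:P) ^+ k)`_i)) // [in RHS](bigID (fun k : 'I_N => (k < size p)%N)) /=.
rewrite [X in _ = _ + X]big1 ?addr0; last first.
  by move=> k; rewrite -leqNgt => /(nth_default 0)->; rewrite mul0r mul0rn.
apply: eq_bigr => k _; rewrite coefZ -mulrnAr; congr (_ * _).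
rewrite addrC exprDn coef_sum.
case: (leqP i k) => [ik|ki]; last first.
  rewrite bin_small // mulr0n big1 // => j _.
  rewrite coefMn -polyC_exp coefCM coefXn (_ : (i == j) = false) ?mulr0 ?mul0rn //.
  by have := ltn_ord j; lia.
rewrite (bigD1 (inord i)) //= inordK ?ltnS // big1 ?addr0 => [|j].
  by rewrite coefMn -polyC_exp coefCM coefXn eqxx mulr1.
rewrite -val_eqE /= inordK ?ltnS // => ji.
by rewrite coefMn -polyC_exp coefCM coefXn eq_sym (negPf ji) mulr0 mul0rn.
Qed.

(** * Substitution, Taylor expansion and chain rule on a lattice of exponents *)

Section FormalSeries.
Variable R : realType.
Implicit Types (a b e : fseries R) (g : series2 R).

Lemma fmul_neq0 a b q : fmul a b q != 0 ->
  exists p, a p != 0 /\ b (q - p) != 0.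
Proof. by move=> /fsum_neq0[p]; rewrite mulf_eq0 negb_or => /andP[]; exists p. Qed.

Lemma fexpS a k : fexp a k.+1 = fmul a (fexp a k).
Proof. by []. Qed.

Lemma fexp_ge a (c : rat) : (forall q, a q != 0 -> c <= q) ->
  forall k q, fexp a k q != 0 -> c * k%:R <= q.
Proof.
move=> ac; elim=> [|k IH] q.
  by rewrite /fexp /= /fone; case: (q =P 0) => [->|]; rewrite ?mulr0 ?eqxx.
rewrite fexpS => /fmul_neq0[p [/ac cp /IH]]; rewrite -natr1; lra.
Qed.

Lemma translate_neq0 g a i q : translate g a i q != 0 ->
  exists k j, [/\ g k j != 0, (i <= k)%N & fexp a (k - i) (q - j%:R) != 0].
Proof.
move=> /fsum_neq0[[k j]] /=; rewrite !mulf_eq0 !negb_or pnatr_eq0 -lt0n bin_gt0.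
by move=> /andP[/andP[gkj ik] akj]; exists k, j.
Qed.

Lemma translate0 g a : translate g a 0 = subst g a.
Proof.
by apply/funext => q; apply: eq_fsbigr => -[k j] _ /=; rewrite bin0 mulr1 subn0.
Qed.

Variable K : nat.
Hypothesis K_gt0 : (0 < K)%N.

Notation lat n := (n%:R / K%:R : rat).

Let K_neq0 : K%:R != 0 :> rat.
Proof. by rewrite pnatr_eq0 -lt0n. Qed.

Lemma lat_inj (m n : nat) : lat m = lat n -> m = n.
Proof. by move/(divIf K_neq0)/eqP; rewrite eqr_nat => /eqP. Qed.

Lemma latB (m n : nat) : (m <= n)%N -> lat n - lat m = lat (n - m)%N.
Proof. by move=> mn; rewrite natrB // mulrBl. Qed.

Lemma lat_mul (j : nat) : lat (K * j)%N = j%:R.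
Proof. by rewrite natrM mulrAC mulfV // mul1r. Qed.

Definition on_lattice a := forall q, a q != 0 -> exists n : nat, q = lat n.

(** Positive indices make the k-th power start at index k, so a given coefficient of a substitution
    involves only finitely many powers. *)
Definition positive_on_lattice a :=
  forall q, a q != 0 -> exists n : nat, q = lat n.+1.

Lemma positive_on_latticeW a : positive_on_lattice a -> on_lattice a.
Proof. by move=> aK q /aK[n ->]; exists n.+1. Qed.

Lemma fmul_lattice a b : on_lattice a -> on_lattice b -> on_lattice (fmul a b).
Proof.
move=> aK bK q /fmul_neq0[p [/aK[m pm] /bK[n qn]]].
by exists (m + n)%N; rewrite natrD mulrDl -pm -qn addrC subrK.
Qed.

Lemma fexp_lattice k a : on_lattice a -> on_lattice (fexp a k).
Proof.
move=> aK; elim: k => [|k IH]; last exact: fmul_lattice.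
move=> q; rewrite /fexp /= /fone; case: (q =P 0) => [->|]; last by rewrite eqxx.
by exists 0%N; rewrite mul0r.
Qed.

#[local] Arguments fexp_lattice k {a}.

Lemma fmul_coef a b n : on_lattice a -> on_lattice b ->
  fmul a b (lat n) = \sum_(i < n.+1) a (lat i) * b (lat (n - i)%N).
Proof.
move=> aK bK; rewrite /fmul (@fsum_seq _ _ _ [seq lat i | i <- iota 0 n.+1]).
- rewrite big_map -[iota _ _]/(index_iota 0 n.+1) big_mkord.
  by apply: eq_bigr => i _; rewrite latB // -ltnS.
- by rewrite map_inj_uniq ?iota_uniq // => i j /lat_inj.
- move=> p; rewrite mulf_eq0 negb_or => /andP[/aK[i ->] /bK[j]] nij.
  apply: (map_f (fun k : nat => lat k)); rewrite mem_iota leq0n add0n ltnS -(ler_nat rat).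
  move/eqP: nij; rewrite -mulrBl => /eqP/(divIf K_neq0) nij.
  by rewrite -subr_ge0 nij ler0n.
Qed.

(* The coefficients of index < B of the series built from a only depend on this
   polynomial, so that identities between series reduce to {poly R[i]}. *)
Definition truncate (B : nat) a : {poly R[i]} := \poly_(n < B) a (lat n).

Lemma fexp_coef a k B n : on_lattice a -> (n < B)%N ->
  fexp a k (lat n) = (truncate B a ^+ k)`_n.
Proof.
move=> aK; elim: k n => [|k IH] n nB.
  rewrite expr0 coef1 /fexp /= /fone mulf_eq0 invr_eq0 (negPf K_neq0) orbF.
  by rewrite pnatr_eq0.
rewrite fexpS fmul_coef //; last exact: fexp_lattice.
rewrite exprS coefM; apply: eq_bigr => i _.
have iB : (i < B)%N by rewrite (leq_trans _ nB).
by rewrite coef_poly iB IH // (leq_ltn_trans _ nB) // leq_subr.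
Qed.

Lemma truncate_exp_gt a k B n : positive_on_lattice a ->
  (truncate B a ^+ k)`_n != 0 -> (k <= n)%N.
Proof.
move=> aK; elim: k n => [//|k IH] n; rewrite exprS coefM.
apply: contra_neqT => kn; apply: big1 => i _; rewrite coef_poly.
case: ifP => _; last by rewrite mul0r.
have [->|/aK[m /lat_inj im]] := eqVneq (a (lat i)) 0; first by rewrite mul0r.
have [->|/IH] := eqVneq ((truncate B a ^+ k)`_(n - i)) 0; rewrite ?mulr0 //.
by move: kn; have := ltn_ord i; lia.
Qed.

Lemma fexp_shift_coef a k j B n : on_lattice a -> (n < B)%N ->
  fexp a k (lat n - j%:R) = (truncate B a ^+ k * 'X^(K * j))`_n.
Proof.
move=> aK nB; rewrite coefMXn; case: ltnP => nj.
  (* Here n/K - j is negative, and powers of a series on the lattice have no negative exponents. *)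
  apply/eqP; apply: contraT => /(fexp_lattice k aK)[l].
  rewrite -(lat_mul j) => /eqP; rewrite -mulrBl => /eqP/(divIf K_neq0) nij.
  have : (n%:R - (K * j)%:R : rat) < 0 by rewrite subr_lt0 ltr_nat.
  by rewrite nij ltrn0.
by rewrite -(lat_mul j) latB // (@fexp_coef _ _ B) // (leq_ltn_trans _ nB) // leq_subr.
Qed.

Lemma translate_lattice g a i : on_lattice a -> on_lattice (translate g a i).
Proof.
move=> aK q /translate_neq0[k [j [_ _ /(fexp_lattice (k - i) aK)[n qn]]]].
by exists (n + K * j)%N; rewrite natrD mulrDl -qn lat_mul subrK.
Qed.

(** The ranges [B1], [B2] and the truncation order [B] only have to be large enough, so each side of
    a later identity can use the ranges that suit it. *)
Lemma translate_coef g a i n B1 B2 B : positive_on_lattice a ->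
  (n + i < B1)%N -> (n < B2)%N -> (n < B)%N ->
  translate g a i (lat n) =
  (\sum_(k < B1) \sum_(j < B2)
     (g k j * 'C(k, i)%:R) *: (truncate B a ^+ (k - i) * 'X^(K * j)))`_n.
Proof.
move=> aK nB1 nB2 nB; have aK' := positive_on_latticeW aK.
rewrite /translate.
rewrite (@fsum_seq _ _ _ [seq (k, j) | k <- index_iota 0 B1, j <- index_iota 0 B2]).
- rewrite big_allpairs big_mkord coef_sum.
  apply: eq_bigr => k _; rewrite big_mkord coef_sum.
  by apply: eq_bigr => j _; rewrite coefZ (fexp_shift_coef _ _ _ nB).
- by apply: allpairs_uniq; rewrite ?iota_uniq // => -[? ?] [? ?].
- move=> [k j] /=; rewrite !mulf_eq0 !negb_or pnatr_eq0 -lt0n bin_gt0.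
  move=> /andP[/andP[_ ik]]; rewrite (fexp_shift_coef _ _ _ nB) //.
  rewrite coefMXn; case: ltnP => nj; rewrite ?eqxx // => /(truncate_exp_gt aK) kn.
  apply/allpairsP; exists (k, j); rewrite !mem_index_iota /=; split=> //; last first.
    rewrite (leq_ltn_trans _ nB2) //; exact: leq_trans (leq_pmull _ K_gt0) nj.
  by rewrite (leq_ltn_trans _ nB1) // -leq_subLR; lia.
Qed.

Lemma positive_on_lattice_add a e : positive_on_lattice a ->
  positive_on_lattice e -> positive_on_lattice (fadd a e).
Proof.
move=> aK eK q; rewrite /fadd.
by have [->|/aK //] := eqVneq (a q) 0; rewrite add0r => /eK.
Qed.

(** Taylor's formula: truncate g to a polynomial P in X over polynomials in t; then P(X + a + e) is
    P(X + a) composed with X + e. *)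
Lemma translate_add g a e i n B : positive_on_lattice a ->
  positive_on_lattice e -> (n + i < B)%N ->
  translate g (fadd a e) i (lat n) =
  \sum_(k < B) \sum_(l < n.+1)
    translate g a k (lat l) * fexp e (k - i) (lat (n - l)%N) *+ 'C(k, i).
Proof.
move=> aK eK nB; have nB' : (n < B)%N by rewrite (leq_ltn_trans _ nB) // leq_addr.
(* The coefficient of X^k in g, written in t with y = t^K. *)
pose c k : {poly R[i]} := \sum_(j < B) g k j *: 'X^(K * j).
pose P : {poly {poly R[i]}} := \poly_(k < B) c k.
have PE b k l : positive_on_lattice b -> (l + k < B)%N ->
    translate g b k (lat l) = (P \Po ('X + (truncate B b)%:P))`_k`_l.
  move=> bK lkB; have lB : (l < B)%N by rewrite (leq_ltn_trans _ lkB) // leq_addr.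
  rewrite (translate_coef _ bK lkB lB lB) (@coef_comp_polyDX _ _ _ _ B) ?size_poly //.
  congr ((_ : {poly _})`_l); apply: eq_bigr => m _; rewrite coef_poly ltn_ord mulr_suml -sumrMnl.
  by apply: eq_bigr => j _; rewrite -scalerAl scalerMnl mulr_natr [in RHS]mulrC.
rewrite (PE _ _ _ (positive_on_lattice_add aK eK) nB).
have -> : truncate B (fadd a e) = truncate B a + truncate B e.
  by apply/polyP => j; rewrite coefD !coef_poly; case: ifP; rewrite // addr0.
have -> : 'X + (truncate B a + truncate B e)%:P =
    ('X + (truncate B a)%:P) \Po ('X + (truncate B e)%:P).
  by rewrite comp_polyD comp_polyX comp_polyC addrAC polyCD addrA.
rewrite comp_polyA (@coef_comp_polyDX _ _ _ _ B); last first.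
  by rewrite size_comp_poly2 ?size_XaddC // size_poly.
rewrite coef_sum; apply: eq_bigr => k _; rewrite coefMn coefM -sumrMnl.
apply: eq_bigr => l _.
have nlB : (n - l < B)%N by rewrite (leq_ltn_trans _ nB') // leq_subr.
rewrite (fexp_coef _ (positive_on_latticeW eK) nlB).
(* [PE] requires l + k < B. If the power of e contributes, then k - i <= n - l, which gives l + k <=
   n + i < B. *)
have [->|/(truncate_exp_gt eK) knl] := eqVneq ((truncate B e ^+ (k - i))`_(n - l)) 0.
  by rewrite !mulr0.
rewrite PE //; have := ltn_ord l; lia.
Qed.

(** Rests on (k+1) C(k,i) = (i+1) C(k+1,i+1). It turns bounds on the Taylor coefficients of f_x into
    bounds on those of f. *)
Lemma translate_dx g a i q : positive_on_lattice a ->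
  translate (dx g) a i q = i.+1%:R * translate g a i.+1 q.
Proof.
move=> aK; have aK' := positive_on_latticeW aK.
have [[n ->]|nq] := pselect (exists n : nat, q = lat n); last first.
  have z g' j : translate g' a j q = 0.
    by apply/eqP/negP => /negP/(translate_lattice aK').
  by rewrite !z mulr0.
rewrite (@translate_coef _ _ _ n (n + i).+1 n.+1 n.+1) //.
rewrite (@translate_coef _ _ _ n (n + i).+2 n.+1 n.+1) ?addnS //.
rewrite [in RHS]big_ord_recl [X in X + _]big1 /= => [|j _]; last first.
  by rewrite bin0n mulr0 scale0r.
rewrite add0r -coefZ; congr ((_ : {poly _})`_n); rewrite scaler_sumr.
apply: eq_bigr => k _; rewrite scaler_sumr; apply: eq_bigr => j _.
rewrite subSS scalerA; congr (_ *: _); rewrite /dx /bump leq0n add1n.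
by rewrite mulrAC -natrM mul_bin_diag natrM; ring.
Qed.

(** With y = t^K and A the arc as a series in t, the operator t d/dt sends f(A, t^K) to t A' f_x + K
    t^K f_y. The first term vanishes, and the coefficients of t^(n+K) are compared. *)
Lemma subst_dy f a n : positive_on_lattice a ->
  (forall q, subst (dx f) a q = 0) ->
  K%:R * subst (dy f) a (lat n) = (n + K)%:R * subst f a (lat (n + K)).
Proof.
move=> aK fx0; have aK' := positive_on_latticeW aK.
pose N := (n + K)%N; pose B := N.+1; pose A := truncate B a.
pose S (b c : nat) (g : series2 R) : {poly R[i]} :=
  \sum_(k < b) \sum_(j < c) g k j *: (A ^+ k * 'X^(K * j)).
have SE (g : series2 R) (b c l : nat) : (l < B)%N -> (l < b)%N -> (l < c)%N ->
    subst g a (lat l) = (S b c g)`_l.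
  move=> lB lb lc; rewrite -translate0 (@translate_coef _ _ _ l b c B) ?addn0 //.
  congr ((_ : {poly _})`_l); apply: eq_bigr => k _; apply: eq_bigr => j _.
  by rewrite bin0 mulr1 subn0.
have nB : (n < B)%N by rewrite ltnS leq_addr.
rewrite (SE _ B.+1 B.+1 N) // (SE _ B.+1 B n) ?(ltnW nB) //; last exact: ltnW.
have -> : (n + K)%:R * (S B.+1 B.+1 f)`_N = ('X * (S B.+1 B.+1 f)^`())`_N.
  rewrite coefXM /N addn_eq0 [K == _]eqn0Ngt K_gt0 andbF coef_deriv.
  by rewrite prednK ?mulr_natl // addn_gt0 K_gt0 orbT.
(* Each range drops by one in the index that its derivative lowers, which makes this an exact
   identity between polynomials. *)
have -> : 'X * (S B.+1 B.+1 f)^`() =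
    'X * A^`() * S B B.+1 (dx f) + K%:R *: ('X^K * S B.+1 B (dy f)).
  rewrite /S linear_sum mulr_sumr.
  have -> : \sum_(k < B.+1) 'X * (\sum_(j < B.+1) f k j *: (A ^+ k * 'X^(K * j)))^`()
     = \sum_(k < B.+1) \sum_(j < B.+1) (k%:R * f k j) *: ('X * A^`() * A ^+ k.-1 * 'X^(K * j))
     + \sum_(k < B.+1) \sum_(j < B.+1) ((K * j)%:R * f k j) *: (A ^+ k * 'X^(K * j)).
    rewrite -big_split; apply: eq_bigr => k _.
    rewrite linear_sum mulr_sumr -big_split; apply: eq_bigr => j _ /=.
    rewrite derivZ derivM deriv_exp derivXn.
    move: (K * j)%N (f k j) => m c.
    rewrite -scalerAr ![_ * c]mulrC -!scalerA -scalerDr; congr (_ *: _).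
    rewrite !scaler_nat mulrDr; congr (_ + _); first by rewrite mulrnAl mulrnAr !mulrA.
    case: m => [|m]; first by rewrite !mulr0n !mulr0.
    by rewrite /= exprS !mulrnAr mulrCA.
  congr (_ + _).
    rewrite big_ord_recl /= big1 ?add0r => [|j _]; last by rewrite mul0r scale0r.
    rewrite mulr_sumr; apply: eq_bigr => k _; rewrite mulr_sumr.
    apply: eq_bigr => j _.
    by rewrite /dx /bump leq0n add1n -scalerAr mulrA.
  rewrite mulr_sumr scaler_sumr; apply: eq_bigr => k _.
  rewrite big_ord_recl /= muln0 mul0r scale0r add0r mulr_sumr scaler_sumr.
  apply: eq_bigr => j _.
  rewrite -scalerAr scalerA /dy /bump leq0n add1n natrM mulnS exprD.
  rewrite -mulrA. congr (_ *: _). by rewrite mulrCA.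
have Q0 l : (l <= N)%N -> (S B B.+1 (dx f))`_l = 0.
  by move=> lN; rewrite -(SE _ B B.+1) ?fx0 // ltnS // ltnW.
clearbody S; rewrite coefD coefZ coefXnM ltnNge leq_addl /= addnK.
rewrite [X in X + _](_ : _ = 0).
  by rewrite add0r.
rewrite coefM big1 // => l _; by rewrite Q0 ?mulr0 // leq_subr.
Qed.
End FormalSeries.
Arguments fexp_lattice {R K} k {a}.

(** * Monomial perturbations, supports and generic parameters *)

Section Monomials.
Variable R : realType.
Implicit Types (a b e : fseries R) (g : series2 R).

Lemma fmul_fmono u p b q : fmul (fmono u p) b q = u * b (q - p).
Proof.
rewrite /fmul (@fsum_seq _ _ _ [:: p]) // => [|r]; first by rewrite big_seq1 /fmono eqxx.
by rewrite /fmono inE; case: (r == p); rewrite // mul0r eqxx.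
Qed.

Lemma fexp_fmono (u : R[i]) p k : fexp (fmono u p) k = fmono (u ^+ k) (p * k%:R).
Proof.
elim: k => [|k IH]; first by apply/funext => q; rewrite /fexp /= /fone /fmono mulr0; case: eqP.
apply/funext => q; rewrite fexpS IH fmul_fmono /fmono exprS -natr1 mulrDr mulr1.
by rewrite subr_eq; case: eqP; rewrite ?mulr0.
Qed.

Lemma fmono_lattice K (u : R[i]) s : (0 < K)%N -> (0 < s)%N ->
  positive_on_lattice K (fmono u (s%:R / K%:R)).
Proof.
move=> K0 s0 q; rewrite /fmono; case: (q =P _) => [->|]; last by rewrite eqxx.
by move=> _; exists s.-1; rewrite prednK.
Qed.

Lemma lattice_min K a q : (0 < K)%N -> on_lattice K a -> a q != 0 ->
  exists2 q0, a q0 != 0 & forall p, a p != 0 -> q0 <= p.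
Proof.
move=> K0 aK aq; have ex : exists n : nat, a (n%:R / K%:R) != 0.
  by have [n qn] := aK _ aq; exists n; rewrite -qn.
have [n an nmin] := ex_minnP ex; exists (n%:R / K%:R) => // p ap.
have [m pm] := aK _ ap; rewrite pm ler_pM2r ?invr_gt0 ?ltr0n // ler_nat.
by apply: nmin; rewrite -pm.
Qed.

Lemma lattice_dilate K L a : (0 < L)%N -> positive_on_lattice K a ->
  positive_on_lattice (K * L) a.
Proof.
move=> L0 aK q /aK[n ->]; exists (n.+1 * L).-1; rewrite prednK ?muln_gt0 //.
by rewrite !natrM -mulf_div divff ?mulr1 // pnatr_eq0 -lt0n.
Qed.

Lemma translate_add_neq0 K g a e i q : (0 < K)%N -> positive_on_lattice K a ->
  positive_on_lattice K e -> translate g (fadd a e) i q != 0 ->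
  exists k p r, [/\ (i <= k)%N, translate g a k p != 0, fexp e (k - i) r != 0 & q = p + r].
Proof.
move=> K0 aK eK nz.
have [n qn] := translate_lattice K0 (positive_on_latticeW (positive_on_lattice_add aK eK)) nz.
move: nz; rewrite qn (@translate_add _ _ K0 _ _ _ _ _ (n + i).+1) //.
move=> /sum_neq0[k /sum_neq0[l]]; rewrite mulrn_eq0 negb_or mulf_eq0 negb_or.
move=> /andP[]; rewrite -lt0n bin_gt0 => ik /andP[ak ek].
exists k, (l%:R / K%:R), ((n - l)%:R / K%:R); split=> //.
by rewrite natrB -1?ltnS // mulrBl addrC subrK.
Qed.

Lemma nonzero_poly_nonroot (p : {poly R[i]}) (A : set R[i]) : p != 0 -> finite_set A ->
  exists2 u, ~~ root p u & ~ A u.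
Proof.
move=> p0 /finite_seqP[s As].
(* The excluded values become roots of P as well. The integers below [size P] are distinct in
   characteristic 0 and too many to be all roots of P. *)
pose P := p * \prod_(x <- s) ('X - x%:P).
have P0 : P != 0 by rewrite mulf_neq0 // monic_neq0 // monic_prod_XsubC.
have : ~~ all (root P) [seq i%:R | i <- iota 0 (size P)].
  apply/negP => /(max_poly_roots P0).
  rewrite map_inj_uniq ?iota_uniq => [/(_ isT)|x y /eqP]; last by rewrite eqr_nat => /eqP.
  by rewrite size_map size_iota ltnn.
move=> /allPn[u _]; rewrite rootM negb_or => /andP[pu su]; exists u => //.
by move: su; rewrite root_prod_XsubC As => /negP.
Qed.

End Monomials.

(** * Planar convex sets *)

Section Planar.
Variable R : realType.
Implicit Types (S P A B : set (R * R)) (p z w : R * R).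

Lemma convex_setP A : @convex_set R (R^o * R^o)%type A <->
  forall x y t, 0 <= t <= 1 -> A x -> A y ->
    A (t * x.1 + (1 - t) * y.1, t * x.2 + (1 - t) * y.2).
Proof.
split=> [cA x y t /andP[t0 t1] Ax Ay|cA x y t /set_mem Ax /set_mem Ay].
  by have /set_mem := cA x y (Itv01 t0 t1) (mem_set Ax) (mem_set Ay).
apply/mem_set; apply: (cA x y t%:num) => //.
by apply/andP; split.
Qed.

Lemma sub_convex_hull A : A `<=` convex_hull A.
Proof. by move=> p Ap K [_]; apply. Qed.

Lemma convex_hull_min A (P : set (R * R)) :
  @convex_set R (R^o * R^o)%type P -> A `<=` P -> convex_hull A `<=` P.
Proof. by move=> cP AP p; apply. Qed.

Lemma convex_hull_convex A : @convex_set R (R^o * R^o)%type (convex_hull A).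
Proof.
apply/convex_setP => x y t t01 Ax Ay K KA.
by have [/convex_setP cK _] := KA; apply: cK; [|exact: Ax|exact: Ay].
Qed.

Lemma convex_hullP A x y t : 0 <= t <= 1 -> convex_hull A x -> convex_hull A y ->
  convex_hull A (t * x.1 + (1 - t) * y.1, t * x.2 + (1 - t) * y.2).
Proof. exact: (convex_setP _).1 (@convex_hull_convex A) x y t. Qed.

Lemma convex_hullS A B : A `<=` B -> convex_hull A `<=` convex_hull B.
Proof.
move=> AB; apply: convex_hull_min; first exact: convex_hull_convex.
exact: subset_trans AB (@sub_convex_hull B).
Qed.

Definition upset S := forall p u v, S p -> 0 <= u -> 0 <= v -> S (p.1 + u, p.2 + v).

Lemma upset_le S p w : upset S -> S p -> p.1 <= w.1 -> p.2 <= w.2 -> S w.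
Proof.
move=> uS Sp p1 p2; have := uS p (w.1 - p.1) (w.2 - p.2) Sp.
by rewrite !subr_ge0 ![_ + (_ - _)]addrC !subrK -surjective_pairing; apply.
Qed.

Lemma convex_hull_upset S : upset S -> upset (convex_hull S).
Proof.
move=> uS p u v Sp u0 v0.
suff : convex_hull S `<=` [set p | convex_hull S (p.1 + u, p.2 + v)] by apply.
apply: convex_hull_min => [|q Sq]; last by apply: sub_convex_hull; exact: uS.
apply/convex_setP => x y t t01 /= Sx Sy; have /= := convex_hullP t01 Sx Sy.
rewrite (_ : t * (x.1 + u) + _ = t * x.1 + (1 - t) * y.1 + u); last by ring.
by rewrite (_ : t * (x.2 + v) + _ = t * x.2 + (1 - t) * y.2 + v); last by ring.
Qed.

(** Weights of positive sum, rather than of sum 1, let the induction drop the last weight without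
    renormalizing the others. *)
Lemma convex_sum_cone P : @convex_set R (R^o * R^o)%type P ->
  forall n (l : 'I_n -> R) (p : 'I_n -> R * R),
  (forall i, 0 <= l i) -> (forall i, P (p i)) -> 0 < \sum_i l i ->
  P ((\sum_i l i * (p i).1) / (\sum_i l i), (\sum_i l i * (p i).2) / (\sum_i l i)).
Proof.
move=> /convex_setP cP; elim=> [|n IH] l p l0 Pp; first by rewrite big_ord0 ltxx.
rewrite !big_ord_recr /=.
set s := \sum_(i < n) l _; set x := \sum_(i < n) _ * _; set y := \sum_(i < n) _ * _.
set a := l ord_max => sa.
have s0 : 0 <= s by apply: sumr_ge0.
have a0 : 0 <= a by apply: l0.
have [sE|s_neq0] := eqVneq s 0.
  have li0 i : l (widen_ord (leqnSn n) i) = 0.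
    move/eqP: sE; rewrite /s psumr_eq0 // => /allP/(_ i).
    by rewrite mem_index_enum => /(_ isT)/eqP.
  have -> : x = 0 by rewrite /x big1 // => i _; rewrite li0 mul0r.
  have -> : y = 0 by rewrite /y big1 // => i _; rewrite li0 mul0r.
  rewrite sE !add0r in sa *; rewrite ![a * _]mulrC !mulfK ?gt_eqF //.
  by rewrite -surjective_pairing.
have s_gt0 : 0 < s by rewrite lt_neqAle eq_sym s_neq0.
have := cP _ _ (s / (s + a)) _ (IH _ (fun i => p (widen_ord (leqnSn n) i)) _ _ s_gt0) (Pp ord_max).
rewrite -/x -/y /=.
have -> : 1 - s / (s + a) = a / (s + a) by field; rewrite gt_eqF.
have -> : s / (s + a) * (x / s) + a / (s + a) * (p ord_max).1 =
  (x + a * (p ord_max).1) / (s + a) by field; rewrite !gt_eqF.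
have -> : s / (s + a) * (y / s) + a / (s + a) * (p ord_max).2 =
  (y + a * (p ord_max).2) / (s + a) by field; rewrite !gt_eqF.
apply=> //; rewrite divr_ge0 ?(ltW sa) //= ler_pdivrMr // mul1r.
by rewrite lerDl.
Qed.

Lemma convex_sum P : @convex_set R (R^o * R^o)%type P ->
  forall n (l : 'I_n -> R) (p : 'I_n -> R * R),
  (forall i, 0 <= l i) -> (forall i, P (p i)) -> \sum_i l i = 1 ->
  P (\sum_i l i * (p i).1, \sum_i l i * (p i).2).
Proof.
move=> cP n l p l0 Pp l1; have := convex_sum_cone cP l0 Pp.
by rewrite l1 !divr1; apply.
Qed.

(** A point of P at distance less than e from w is dominated by w + (e, e), so limits need only be
    tested along the diagonal. *)
Lemma closed_upset P : upset P ->
  (forall w, (forall e, 0 < e -> P (w.1 + e, w.2 + e)) -> P w) -> closed P.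
Proof.
move=> uP cP w clw; apply: cP => e e0.
have [p [Pp [p1 p2]]] := clw _ (nbhsx_ballx w e e0).
apply: (upset_le uP Pp) => /=.
- by have := p1; rewrite /ball /= ltr_distlC => /andP[_ /ltW].
- by have := p2; rewrite /ball /= ltr_distlC => /andP[_ /ltW].
Qed.

(** The hull consists of the points dominating some convex combination of the p i, and these
    combinations are parametrized by a compact simplex [D]. *)
Lemma convex_hull_closed n (p : 'I_n -> R * R) S : upset S ->
  (0 < n)%N -> (forall i, S (p i)) ->
  (forall w, S w -> exists i, (p i).1 <= w.1 /\ (p i).2 <= w.2) ->
  closed (convex_hull S).
Proof.
move=> uS n0 Sp pS.
pose D := [set l : 'rV[R]_n | (forall i, `[0, 1]%classic (l ord0 i))] `&`
          [set l : 'rV[R]_n | \sum_i l ord0 i = 1].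
pose x (l : 'rV[R]_n) := \sum_i l ord0 i * (p i).1.
pose y (l : 'rV[R]_n) := \sum_i l ord0 i * (p i).2.
pose E := [set w | exists l, [/\ D l, x l <= w.1 & y l <= w.2]].
have csum (c : 'I_n -> R) : continuous (fun l : 'rV[R]_n => \sum_i l ord0 i * c i).
  apply: continuous_big => [|i _ l]; first exact: add_continuous.
  apply: (@continuousM R _ (fun l : 'rV[R]_n => l ord0 i) (cst (c i))).
    exact: coord_continuous.
  exact: cst_continuous.
have D_compact : compact D.
  apply: compact_closedI; first exact: (@rV_compact R n (fun=> `[0, 1]%classic) (fun=> @segment_compact R 0 1)).
  have sum1_cont : continuous (fun l : 'rV[R]_n => \sum_i l ord0 i).
    rewrite (_ : (fun _ => _) = fun l : 'rV[R]_n => \sum_i l ord0 i * (fun=> 1) i).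
      exact: csum.
    by apply/funext => l; apply: eq_bigr => i _; rewrite mulr1.
  apply: (@preimage_closed _ _ (fun l : 'rV[R]_n => \sum_i l ord0 i) [set 1]) => [l _|].
    exact: sum1_cont.
  exact: closed_eq.
pose b i : 'rV[R]_n := \row_j (j == i)%:R.
have bsum i (c : 'I_n -> R) : \sum_j b i ord0 j * c j = c i.
  rewrite (bigD1 i) //= big1 ?addr0 => [|j /negPf ji]; first by rewrite mxE eqxx mul1r.
  by rewrite mxE ji mul0r.
have bD i : D (b i).
  split=> [j|] /=; first by rewrite in_itv /= mxE ler0n lern1 leq_b1.
  by rewrite -[RHS](bsum i (fun=> 1)); apply: eq_bigr => j _; rewrite mulr1.
have DE w : S w -> E w.
  by move=> /pS[i [px py]]; exists (b i); split; rewrite // /x /y bsum.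
have ES : E `<=` convex_hull S.
  move=> w [l [[l01 l1] xw yw]].
  apply: (@upset_le _ (x l, y l) w (convex_hull_upset uS) _ xw yw).
  apply: (convex_sum (@convex_hull_convex S)) => // i.
    by have /= := l01 i; rewrite in_itv /= => /andP[].
  exact: sub_convex_hull.
have SE : convex_hull S `<=` E.
  apply: convex_hull_min => //; apply/convex_setP => w1 w2 t /andP[t0 t1].
  move=> [l [[l01 l1] xl yl]] [m [[m01 m1] xm ym]].
  have tsum (c : 'I_n -> R) : \sum_i (t *: l + (1 - t) *: m) ord0 i * c i =
      t * (\sum_i l ord0 i * c i) + (1 - t) * \sum_i m ord0 i * c i.
    rewrite !mulr_sumr -big_split; apply: eq_bigr => i _; rewrite !mxE /=; ring.
  have t1' : 0 <= 1 - t by rewrite subr_ge0.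
  exists (t *: l + (1 - t) *: m); split=> /=; last 2 first.
  - by rewrite /x tsum lerD // ler_wpM2l.
  - by rewrite /y tsum lerD // ler_wpM2l.
  split=> [i|] /=.
    move: (l01 i) (m01 i); rewrite /= !in_itv /= !mxE => /andP[? ?] /andP[? ?].
    by apply/andP; split; nra.
  have mul1E (k : 'rV[R]_n) : \sum_i k ord0 i * 1 = \sum_i k ord0 i.
    by apply: eq_bigr => i _; rewrite mulr1.
  have := tsum (fun=> 1); rewrite !mul1E l1 m1 => ->; ring.
apply: closed_upset; first exact: convex_hull_upset.
move=> w wS; apply: ES.
(* [d l <= 0] says that w dominates the combination of weights l. The minimum of d on the simplex is
   at most every e > 0, and it is attained. *)
pose d l := Num.max (x l - w.1) (y l - w.2).
have d_cont : continuous d.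
  move=> l; apply: (@continuous_max R _ (fun l => x l - w.1) (fun l => y l - w.2)).
    apply: (@continuousB R R^o _ x (cst w.1)); first exact: csum.
    exact: cst_continuous.
  apply: (@continuousB R R^o _ y (cst w.2)); first exact: csum.
  exact: cst_continuous.
have [l /set_mem Dl dl] := EVT_min_rV (ex_intro _ _ (bD (Ordinal n0))) D_compact (continuous_subspaceT d_cont).
exists l.
have : d l <= 0.
  apply/ler_addgt0Pr => e e0; rewrite add0r.
  have [m [Dm xm ym]] := SE _ (wS e e0).
  rewrite (le_trans (dl m (mem_set Dm))) // ge_max /= !lerBlDl; exact/andP.
by rewrite ge_max !subr_le0 => /andP[xl yl]; split.
Qed.

(** The boundary point is at the supremum of the parameters that stay in P. The bounds on a and b
    make each coordinate move no faster than t. *)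
Lemma boundary_ray P p a b M : closed P -> P p -> `|a| <= 1 -> `|b| <= 1 ->
  (forall t, 0 <= t -> P (p.1 + t * a, p.2 + t * b) -> t <= M) ->
  exists2 t, 0 <= t & boundary P (p.1 + t * a, p.2 + t * b).
Proof.
move=> clP Pp a1 b1 TM.
pose T := [set t | 0 <= t /\ P (p.1 + t * a, p.2 + t * b)].
have T0 : T 0 by split=> //; rewrite !mul0r !addr0 -surjective_pairing.
have supT : has_sup T by split; [exists 0|exists M => t [/TM]; apply].
have sup_ge0 : 0 <= sup T by apply: ub_le_sup => //; case: supT.
have near_le (t e c : R) : `|c| <= 1 -> `|sup T - t| < e ->
    `|(sup T * c) - (t * c)| < e.
  by move=> c1; apply: le_lt_trans; rewrite -mulrBl normrM ler_piMr.
exists (sup T) => //; split.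
  move=> B /nbhs_ballP[e /= e0 eB].
  have [t Tt te] := sup_adherent e0 supT.
  have tsup : t <= sup T by apply: ub_le_sup => //; case: supT.
  have d : `|sup T - t| < e by rewrite ger0_norm ?subr_ge0 //; lra.
  exists (p.1 + t * a, p.2 + t * b); split; first by case: Tt.
  by apply: eB; split; rewrite /ball /= opprD addrACA subrr add0r; exact: near_le.
move=> /nbhs_ballP[e /= e0 eB].
have : T (sup T + e / 2).
  split; first by rewrite addr_ge0 // divr_ge0 // ltW.
  have d : `|sup T - (sup T + e / 2)| < e.
    by rewrite opprD addNKr normrN gtr0_norm; lra.
  by apply: eB; split; rewrite /ball /= opprD addrACA subrr add0r; exact: near_le.
move=> Tt; have : sup T + e / 2 <= sup T by apply: ub_le_sup => //; case: supT.
lra.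
Qed.

(** The antidiagonal through p leaves the quadrant with corner c on both sides, so p lies between
    two boundary points of P. *)
Lemma sub_convex_hull_boundary P c : closed P ->
  (forall p, P p -> c.1 <= p.1 /\ c.2 <= p.2) -> P `<=` convex_hull (boundary P).
Proof.
move=> clP Pc p Pp.
have n1 : `|1| <= 1 :> R by rewrite normr1.
have nN1 : `|-1| <= 1 :> R by rewrite normrN1.
have [|t t0 bt] := @boundary_ray P p 1 (-1) (p.2 - c.2) clP Pp n1 nN1.
  by move=> t _ /Pc[_ /=]; lra.
have [|s s0 bs] := @boundary_ray P p (-1) 1 (p.1 - c.1) clP Pp nN1 n1.
  by move=> s _ /Pc[/=]; lra.
have [st0|st0] := eqVneq (s + t) 0.
  have t00 : t = 0 by lra.
  by move: bt; rewrite t00 !mul0r !addr0 -surjective_pairing; apply: sub_convex_hull.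
have st_gt0 : 0 < s + t by rewrite lt_neqAle eq_sym st0 addr_ge0.
have := @convex_hullP _ _ _ (s / (s + t)) _ (sub_convex_hull bt) (sub_convex_hull bs).
rewrite /= [X in convex_hull _ (X, _)](_ : _ = p.1); last by field.
rewrite [X in convex_hull _ (_, X)](_ : _ = p.2); last by field.
rewrite -surjective_pairing; apply.
by rewrite divr_ge0 ?(ltW st_gt0) //= ler_pdivrMr // mul1r lerDl.
Qed.

Lemma convex_hull_boundaryU P c z : @convex_set R (R^o * R^o)%type P -> closed P ->
  (forall p, P p -> c.1 <= p.1 /\ c.2 <= p.2) ->
  convex_hull (boundary P `|` [set z]) = convex_hull (P `|` [set z]).
Proof.
move=> cP clP Pc; apply/seteqP; split.
  apply: convex_hullS => p [[clp _]|->]; [left|by right].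
  exact: clP.
apply: convex_hull_min; first exact: convex_hull_convex.
move=> p [Pp|->]; last by apply: sub_convex_hull; right.
apply: (convex_hullS _ (sub_convex_hull_boundary clP Pc Pp)).
by move=> q bq; left.
Qed.

Lemma convex_hullU A z : convex_hull (convex_hull A `|` [set z]) = convex_hull (A `|` [set z]).
Proof.
apply/seteqP; split; last first.
  by apply: convex_hullS => p [/sub_convex_hull|->]; [left|right].
apply: convex_hull_min; first exact: convex_hull_convex.
move=> p [|->]; last by apply: sub_convex_hull; right.
by apply: convex_hullS => q Aq; left.
Qed.

Lemma convex_hull_segment S (i k g h j : R) : upset S -> S (k, g) ->
  0 < i -> i <= k -> (1 - i / k) * h + i / k * g <= j ->
  convex_hull (S `|` [set (0, h)]) (i, j).
Proof.
move=> uS Sk i0 ik hj; have k0 : 0 < k by exact: lt_le_trans ik.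
set r := j - ((1 - i / k) * h + i / k * g) in hj *.
have r0 : 0 <= r by rewrite subr_ge0.
(* The apex (0, h) cannot be raised, so all the slack r is put at abscissa k; the factor k / i makes
   the segment pass exactly through (i, j). *)
have Sk' : S (k, g + r * (k / i)).
  have := uS _ 0 (r * (k / i)) Sk; rewrite /= addr0; apply=> //.
  by rewrite mulr_ge0 // divr_ge0 // ltW.
have ik01 : 0 <= i / k <= 1.
  by rewrite divr_ge0 ?(ltW i0) ?(ltW k0) //= ler_pdivrMr // mul1r.
have := @convex_hullP (S `|` [set (0, h)]) _ _ _ ik01
  (sub_convex_hull (or_introl Sk')) (sub_convex_hull (or_intror erefl)).
rewrite /= [X in convex_hull _ (X, _)](_ : _ = i); last by field; rewrite gt_eqF.
by rewrite [X in convex_hull _ (_, X)](_ : _ = j) // /r; field; rewrite !gt_eqF.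
Qed.

End Planar.

(** * Arcs with the same image are conjugate *)

Section Orders.
Variable R : realType.
Implicit Types (a b : fseries R).

Lemma ord_geP a (x : R) :
  (x%:E <= ord a)%E <-> forall q, a q != 0 -> x <= ratr q.
Proof.
split=> [xa q aq|xa].
  rewrite -lee_fin (le_trans xa) //; apply: ereal_inf_lbound.
  by exists q => //; exact/eqP.
by apply: le_ereal_inf_tmp => _ [q /eqP/xa xq <-]; rewrite lee_fin.
Qed.

Lemma F1_ge1 a : F1 a -> forall q, a q != 0 -> 1 <= q.
Proof. by move=> [_ /ord_geP a1] q /a1; rewrite -(rmorph1 ratr) ler_rat. Qed.

Lemma supported_in_lattice a N : F1 a -> (0 < N)%N -> supported_in a N ->
  positive_on_lattice N a.
Proof.
move=> a1 N0 aN q aq; have q1 := F1_ge1 a1 aq.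
have NQ : 0 < N%:R :> rat by rewrite ltr0n.
have : q * N%:R \is a Num.nat.
  by rewrite natrEint aN /= ?mulr_ge0 ?(le_trans _ q1) ?ltW //; exact/eqP.
move=> /natrP[[|n] qn]; last by exists n; rewrite -qn mulfK // gt_eqF.
by move: qn => /eqP; rewrite mulf_eq0 !gt_eqF // (lt_le_trans _ q1).
Qed.

Lemma ramification_exists a : F1 a -> exists N, is_ramification a N.
Proof.
move=> [[N [N0 aN _ _]] _].
have ex : exists N, (fun N => `[< (0 < N)%N /\ supported_in a N >]) N by exists N; exact/asboolP.
case: (ex_minnP ex) => M /asboolP[M0 aM] Mmin.
by exists M; split=> // M' M'0 aM'; apply: Mmin; exact/asboolP.
Qed.

Lemma ramification_uniq a N M : is_ramification a N -> is_ramification a M -> N = M.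
Proof.
move=> [N0 aN Nmin] [M0 aM Mmin].
by apply/eqP; rewrite eqn_leq Nmin // Mmin.
Qed.

(** Convergence is given for some denominator N' of the exponents, whereas [arc_image] uses the
    minimal one; the bound is moved from N' to N. *)
Lemma F1_coef_bound a N : F1 a -> (0 < N)%N -> supported_in a N ->
  exists r B : R[i], [/\ 0 < r, 0 <= B &
    forall k, `|a (k%:R / N%:R)| * r ^+ k <= B].
Proof.
move=> [[N' [N'0 aN' _ [r [B [r0 rB]]]]] _] N0 aN.
have r1_gt0 : 0 < 1 + r by rewrite addr_gt0.
(* [s <= r] keeps the bound for N'. If k/N = l/N', then (s^N')^k = s^(l N) <= s^l because
   [s < 1]. *)
pose s := r / (1 + r).
have s_gt0 : 0 < s by rewrite divr_gt0.
have s_lt1 : s < 1 by rewrite /s ltr_pdivrMr // mul1r ltrDr.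
have s_ler : s <= r by rewrite /s ler_pdivrMr // mulrDr mulr1 lerDl mulr_ge0 // ltW.
have aB k : `|a (k%:R / N'%:R)| * s ^+ k <= B.
  apply: (le_trans _ (rB k.+1)); rewrite big_ord_recr /=.
  apply: (@le_trans _ _ (`|a (k%:R / N'%:R)| * r ^+ k)).
    by rewrite ler_wpM2l // lerXn2r // nnegrE ltW.
  by rewrite lerDr sumr_ge0 // => i _; rewrite mulr_ge0 // exprn_ge0 // ltW.
have B0 : 0 <= B by apply: le_trans (rB 0%N); rewrite big_ord0.
exists (s ^+ N'), B; split=> // [|k]; first exact: exprn_gt0.
have [->|ak] := eqVneq (a (k%:R / N%:R)) 0; first by rewrite normr0 mul0r.
have kl : (k%:R / N%:R * N'%:R : rat) \is a Num.nat.
  by rewrite natrEint aN' ?mulr_ge0 ?invr_ge0 //; exact/eqP.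
have [l kE] := natrP kl.
have NQ : N%:R != 0 :> rat by rewrite pnatr_eq0 -lt0n.
have N'Q : N'%:R != 0 :> rat by rewrite pnatr_eq0 -lt0n.
have akl : k%:R / N%:R = l%:R / N'%:R :> rat by rewrite -kE mulfK.
have klN : (k * N' = l * N)%N.
  by apply/eqP; rewrite -(eqr_nat rat) !natrM -kE mulrAC divfK.
apply: le_trans (aB l); rewrite akl ler_wpM2l // -exprM mulnC klN.
by rewrite ler_wiXn2l ?ltW // leq_pmulr.
Qed.

End Orders.

(** * Tails of power series and a pointwise identity theorem *)

Section PowerSeries.
Variable R : realType.
Implicit Types (c : nat -> R[i]) (t : R[i]).

Lemma powerseries_term_le c (r B : R[i]) t : 0 < r ->
  (forall k, `|c k| * r ^+ k <= B) -> forall k, `|c k * t ^+ k| <= B * (`|t| / r) ^+ k.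
Proof.
move=> r0 cB k; have rk : r ^+ k != 0 by rewrite expf_neq0 // gt_eqF.
have -> : `|c k * t ^+ k| = `|c k| * r ^+ k * (`|t| / r) ^+ k.
  by rewrite normrM normrX expr_div_n -mulrA [r ^+ k * _]mulrC divfK.
by rewrite ler_wpM2r // exprn_ge0 // divr_ge0 // ltW.
Qed.

(** The ratio |t|/r is at most 1/2, so a tail is at most twice the bound on its first term. *)
Lemma geometric_tail c (r B : R[i]) t : 0 < r -> 0 <= B ->
  (forall k, `|c k| * r ^+ k <= B) -> 2 * `|t| <= r ->
  forall L n, (L <= n)%N ->
  `|\sum_(L <= k < n) c k * t ^+ k| <= 2 * B / r ^+ L * `|t| ^+ L.
Proof.
move=> r0 B0 cB tr L n Ln; pose x := `|t| / r.
have x0 : 0 <= x by rewrite divr_ge0 // ltW.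
have x2 : 2 * x <= 1 by rewrite /x mulrA ler_pdivrMr // mul1r.
have cx := powerseries_term_le t r0 cB.
have geo m : \sum_(k < m) x ^+ k <= 2 - 2 * x ^+ m.
  elim: m => [|m IH]; first by rewrite big_ord0 expr0 mulr1 subrr.
  rewrite big_ord_recr /= (le_trans (lerD IH (lexx _))) // exprS.
  have -> : 2 - 2 * x ^+ m + x ^+ m = 2 - x ^+ m by ring.
  by rewrite lerD2l lerN2 mulrA ler_piMl // exprn_ge0.
apply: le_trans (ler_norm_sum _ _ _) _.
apply: le_trans (ler_sum _ (fun k _ => cx k)) _.
rewrite -{1}(add0n L) -{1}(subnK Ln) big_addn addnK big_mkord.
under eq_bigr do rewrite exprD mulrA mulrAC.
rewrite -mulr_sumr.
have -> : 2 * B / r ^+ L * `|t| ^+ L = B * x ^+ L * 2.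
  by rewrite /x expr_div_n; ring.
apply: ler_wpM2l; first by rewrite mulr_ge0 // exprn_ge0.
apply: le_trans (geo _) _.
by rewrite gerBl mulr_ge0 // exprn_ge0.
Qed.

Lemma cvg_complex (u : nat -> R[i]) (x y : R) :
  (fun n => complex.Re (u n)) @ \oo --> x ->
  (fun n => complex.Im (u n)) @ \oo --> y ->
  (u : nat -> R[i]^o) @ \oo --> (x +i* y : R[i]^o).
Proof.
move=> ux uy; apply/cvgrPdist_lt => e e0.
have e_real : (complex.Re e)%:C = e by rewrite RRe_real // gtr0_real.
have e2 : 0 < complex.Re e / 2 by rewrite divr_gt0 // -ltcR e_real.
move/cvgrPdist_lt : ux => /(_ _ e2); move/cvgrPdist_lt : uy => /(_ _ e2).
have normC (z : R) : `|z%:C| = `|z|%:C.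
  by rewrite normc_def /= expr0n /= addr0 sqrtr_sqr.
have normi : `|'i%C : R[i]| = 1.
  by rewrite normc_def /= expr0n expr1n /= add0r sqrtr1.
apply: filterS2 => n nx ny.
rewrite [X in `|X|]complexE /= (le_lt_trans (ler_normD _ _)) //.
rewrite normrM normi mul1r !normC -rmorphD /= -e_real ltcR.
move: nx ny; case: (u n) => p q /=; lra.
Qed.

Lemma powerseries_cvg c (r B : R[i]) t : 0 < r -> 0 <= B ->
  (forall k, `|c k| * r ^+ k <= B) -> 2 * `|t| <= r ->
  exists x : R[i]^o, series (fun k => c k * t ^+ k : R[i]^o) @ \oo --> x.
Proof.
move=> r0 B0 cB tr; pose x := `|t| / r.
have x0 : 0 <= x by rewrite divr_ge0 // ltW.
have x2 : 2 * x <= 1 by rewrite /x mulrA ler_pdivrMr // mul1r.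
have cx := powerseries_term_le t r0 cB.
have realE (z : R[i]) : 0 <= z -> (complex.Re z)%:C = z.
  by move=> z0; rewrite RRe_real // ger0_real.
have rx0 : 0 <= complex.Re x by rewrite -lecR realE.
have rx1 : `|complex.Re x| < 1.
  rewrite ger0_norm //.
  have : (2 * complex.Re x)%:C <= 1%:C by rewrite rmorphM rmorph_nat /= realE.
  by rewrite lecR; lra.
have cvg_part (w : nat -> R) :
    (forall k, `|w k| <= complex.Re B * complex.Re x ^+ k) -> cvgn (series w).
  move=> wB; apply: normed_cvg.
  apply: (@series_le_cvg _ _ (geometric (complex.Re B) (complex.Re x))) => [n|n|n|].
  - exact: normr_ge0.
  - by rewrite /= mulr_ge0 ?exprn_ge0 // -lecR realE.
  - exact: wB.
  - exact: is_cvg_geometric_series.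
have BE k : B * x ^+ k = (complex.Re B * complex.Re x ^+ k)%:C.
  by rewrite rmorphM rmorphXn /= !realE.
have reB k : `|complex.Re (c k * t ^+ k)| <= complex.Re B * complex.Re x ^+ k.
  by rewrite -lecR -BE (le_trans (normc_ge_Re _)).
have imB k : `|complex.Im (c k * t ^+ k)| <= complex.Re B * complex.Re x ^+ k.
  rewrite -normrN -ReiNIm -lecR -BE (le_trans (normc_ge_Re _)) // normrM.
  by rewrite [X in _ * X](_ : _ = 1) ?mulr1 // normc_def /= expr0n expr1n /= add0r sqrtr1.
have /cvg_ex[/= l lc] := cvg_part _ reB.
have /cvg_ex[/= m mc] := cvg_part _ imB.
pose f k : R[i]^o := c k * t ^+ k.
have ReS : (fun n => complex.Re (series f n)) = series (fun k => complex.Re (f k)).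
  by apply/funext => n; rewrite /series /=; elim/big_rec2: _ => // k p q _ <-; case: (f k) q => ? ? [].
have ImS : (fun n => complex.Im (series f n)) = series (fun k => complex.Im (f k)).
  by apply/funext => n; rewrite /series /=; elim/big_rec2: _ => // k p q _ <-; case: (f k) q => ? ? [].
by exists (l +i* m); apply: cvg_complex; rewrite ?ReS ?ImS.
Qed.

Lemma series_tail_le (f : nat -> R[i]) (x E : R[i]) L :
  series (f : nat -> R[i]^o) @ \oo --> (x : R[i]^o) ->
  (forall n, (L <= n)%N -> `|\sum_(L <= k < n) f k| <= E) ->
  `|x - \sum_(k < L) f k| <= E.
Proof.
move=> fx fE; apply/ler_addgt0Pr => e e0.
have /cvgrPdist_lt/(_ e e0)[n0 _ n0e] := fx.
have := n0e (maxn n0 L) (leq_maxl _ _).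
rewrite /series /= (big_cat_nat _ (n := L)) ?leq_maxr //= big_mkord opprD addrA.
move=> lt_e; rewrite -[X in `|X|](subrK (\sum_(L <= k < maxn n0 L) f k)).
by rewrite (le_trans (ler_normD _ _)) // [leRHS]addrC lerD ?(ltW lt_e) // fE // leq_maxr.
Qed.

Lemma sum_dilate (f : nat -> R[i]) (M L : nat) t : (0 < M)%N ->
  (forall n, f n != 0 -> (M %| n)%N) ->
  \sum_(n < M * L) f n * t ^+ n = \sum_(k < L) f (M * k)%N * (t ^+ M) ^+ k.
Proof.
move=> M0 fM; elim: L => [|L IH]; first by rewrite muln0 !big_ord0.
rewrite mulnS addnC [LHS]big_split_ord /= IH big_ord_recr /=; congr (_ + _).
rewrite (bigD1 (Ordinal M0)) //= addn0 exprM big1 ?addr0 // => i i0.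
have [->|/fM] := eqVneq (f (M * L + i)%N) 0; first by rewrite mul0r.
rewrite dvdn_addr ?dvdn_mulr // => /dvdn_leq; have := ltn_ord i.
by move: i0; rewrite -val_eqE /=; lia.
Qed.

(** Expansions in t^M and in t^N have to be compared in the common variable t. The terms of index
    between L and M L are absorbed into the constant, since t <= 1. *)
Lemma approx_dilate (f : nat -> R[i]) (M : nat) (E t x : R[i]) L : (0 < M)%N ->
  (forall n, f n != 0 -> (M %| n)%N) -> 0 <= E -> 0 <= t <= 1 ->
  `|x - \sum_(k < L) f (M * k)%N * (t ^+ M) ^+ k| <= E * (t ^+ M) ^+ L ->
  `|x - \sum_(n < L) f n * t ^+ n| <= (E + \sum_(L <= n < M * L) `|f n|) * t ^+ L.
Proof.
move=> M0 fM E0 /andP[t0 t1]; rewrite -sum_dilate // => xE.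
have LM : (L <= M * L)%N by rewrite leq_pmull.
rewrite -(big_mkord xpredT (fun n => f n * t ^+ n)).
rewrite -(big_mkord xpredT (fun n => f n * t ^+ n)) in xE.
rewrite (big_cat_nat _ (n := L)) //= opprD addrA in xE.
rewrite -[X in `|X|](subrK (\sum_(L <= n < M * L) f n * t ^+ n)).
rewrite (le_trans (ler_normD _ _)) // mulrDl lerD //.
  by rewrite (le_trans xE) // -exprM ler_wpM2l // ler_wiXn2l.
rewrite (le_trans (ler_norm_sum _ _ _)) // mulr_suml !big_seq ler_sum // => n.
rewrite mem_index_iota => /andP[Ln _].
by rewrite normrM ler_wpM2l // normrX ger0_norm // ler_wiXn2l.
Qed.

(** A leading term d_n t^n cannot be O(t^(n+1)) for small t. The estimate is required only where [V]
    holds, so no function summing the series has to be given. *)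
Lemma small_powerseries_neq0 (d : nat -> R[i]) (V : R[i] -> Prop) :
  (forall L, exists2 E : R[i], 0 <= E & forall t, 0 < t -> V t ->
     `|\sum_(n < L) d n * t ^+ n| <= E * t ^+ L) ->
  (exists n, d n != 0) ->
  exists2 e : R[i], 0 < e & forall t, 0 < t -> t < e -> ~ V t.
Proof.
move=> dV /ex_minnP[n dn nmin]; have [E E0 VE] := dV n.+1.
(* For t below this value, E t < |d n|; the added 1 keeps the denominator nonzero. *)
exists (`|d n| / (E + 1)) => [|t t0 te Vt].
  by rewrite divr_gt0 ?normr_gt0 // ltr_wpDl.
move: te; rewrite ltr_pdivlMr ?ltr_wpDl // => te.
have := VE t t0 Vt; rewrite big_ord_recr /= big1 => [|i _]; last first.
  have [->|/nmin] := eqVneq (d i) 0; first by rewrite mul0r.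
  by rewrite leqNgt ltn_ord.
rewrite add0r normrM normrX (gtr0_norm t0) exprS mulrA ler_pM2r ?exprn_gt0 // => dE.
have := lt_le_trans te dE; rewrite mulrDr mulr1 mulrC -subr_gt0 opprD addrA subrr.
by rewrite sub0r oppr_gt0 (lt_gtF t0).
Qed.

End PowerSeries.

(** * Equality of curve germs implies conjugacy *)

Section Conjugates.
Variable R : realType.
Implicit Types (a b : fseries R).

Lemma common_lower_bound (s : seq R[i]) : (forall x, x \in s -> 0 < x) ->
  exists2 e : R[i], 0 < e & forall x, x \in s -> e < x.
Proof.
elim: s => [|y s IH] s0; first by exists 1.
have [|e e0 es] := IH; first by move=> x xs; apply: s0; rewrite in_cons xs orbT.
have y0 : 0 < y by apply: s0; rewrite mem_head.
have ey0 : 0 < e + y by rewrite addr_gt0.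
(* This lies below both e and y, and replaces their minimum since the order of [R[i]] is only
   partial. *)
exists (e * y / (e + y)) => [|x]; first by rewrite divr_gt0 // mulr_gt0.
rewrite in_cons => /predU1P[->|/es ex].
  by rewrite ltr_pdivrMr // mulrC ltr_pM2l // ltrDl.
by apply: lt_trans ex; rewrite ltr_pdivrMr // ltr_pM2l // ltrDr.
Qed.

Lemma common_threshold (s : seq R[i]) (V : R[i] -> R[i] -> Prop) :
  (forall z, z \in s -> exists2 e : R[i], 0 < e & forall t, 0 < t -> t < e -> ~ V z t) ->
  exists2 e : R[i], 0 < e & forall z t, z \in s -> 0 < t -> t < e -> ~ V z t.
Proof.
elim: s => [|y s IH] sV; first by exists 1.
have [|e e0 es] := IH; first by move=> x xs; apply: sV; rewrite in_cons xs orbT.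
have [e' e'0 ys] := sV y (mem_head _ _).
have [|d d0 de] := @common_lower_bound [:: e; e'].
  by move=> x; rewrite !inE => /orP[]/eqP->.
exists d => // z t; rewrite in_cons => /predU1P[->|zs] t0 td.
  by apply: ys => //; apply: lt_trans td (de _ _); rewrite !inE eqxx orbT.
by apply: es => //; apply: lt_trans td (de _ _); rewrite !inE eqxx.
Qed.

Lemma unity_root_seq (M : nat) : (0 < M)%N ->
  exists s : seq R[i], forall z, z ^+ M = 1 -> z \in s.
Proof.
move=> M0; pose p : {poly R[i]} := 'X^M - 1%:P.
have [s ps] := closed_field_poly_normal p; exists s => z zM.
have : root p z by rewrite rootE !hornerE zM subrr.
by rewrite ps (monicP (monicXnsubC _ M0)) scale1r root_prod_XsubC.
Qed.

Lemma arc_approx a N : F1 a -> is_ramification a N -> exists r B : R[i],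
  [/\ 0 < r, 0 <= B,
    forall t, 2 * `|t| <= r -> exists2 x : R[i]^o,
      series (fun k => a (k%:R / N%:R) * t ^+ k : R[i]^o) @ \oo --> x &
      arc_image a (x, t ^+ N) &
    forall t x, 2 * `|t| <= r ->
      series (fun k => a (k%:R / N%:R) * t ^+ k : R[i]^o) @ \oo --> (x : R[i]^o) ->
      forall L, `|x - \sum_(k < L) a (k%:R / N%:R) * t ^+ k| <= 2 * B / r ^+ L * `|t| ^+ L].
Proof.
move=> a1 aN; have [N0 aN' _] := aN.
have [r [B [r0 B0 aB]]] := F1_coef_bound a1 N0 aN'.
exists r, B; split=> // [t tr|t x tr tx L].
  have [x tx] := powerseries_cvg r0 B0 aB tr.
  by exists x => //; exists N, t; split.
apply: series_tail_le tx _ => n Ln; exact: geometric_tail.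
Qed.

(** For small t > 0 the point of a over y = t^(MN) is also on b, at the parameter z t^N for some z
    with z^M = 1. This z may depend on t, but only finitely many z occur; if none made all
    coefficients agree, each would be ruled out for small t. *)
Lemma curve_germ_conj a b : F1 a -> F1 b -> curve_germ a = curve_germ b ->
  exists M z, [/\ (0 < M)%N, z ^+ M = 1, on_lattice M a, on_lattice M b &
    forall k : nat, a (k%:R / M%:R) = z ^+ k * b (k%:R / M%:R)].
Proof.
move=> a1 b1 ab.
have [N aN] := ramification_exists a1; have [M bM] := ramification_exists b1.
have [N0 aN' _] := aN; have [M0 bM' _] := bM.
have aL := positive_on_latticeW (supported_in_lattice a1 N0 aN').
have bL := positive_on_latticeW (supported_in_lattice b1 M0 bM').
have [ra [Ba [ra0 Ba0 a_ex a_approx]]] := arc_approx a1 aN.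
have [rb [Bb [rb0 Bb0 b_ex b_approx]]] := arc_approx b1 bM.
have NQ : N%:R != 0 :> rat by rewrite pnatr_eq0 -lt0n.
have MQ : M%:R != 0 :> rat by rewrite pnatr_eq0 -lt0n.
pose q (n : nat) : rat := n%:R / (N * M)%:R.
have qN k : q (M * k)%N = k%:R / N%:R by rewrite /q !natrM; field; apply/andP.
have qM k : q (N * k)%N = k%:R / M%:R by rewrite /q !natrM; field; apply/andP.
have a_dvd n : a (q n) != 0 -> (M %| n)%N.
  move=> /aL[k]; rewrite -qN => /lat_inj; rewrite muln_gt0 N0 M0 => /(_ isT) ->.
  exact: dvdn_mulr.
have b_dvd n : b (q n) != 0 -> (N %| n)%N.
  move=> /bL[k]; rewrite -qM => /lat_inj; rewrite muln_gt0 N0 M0 => /(_ isT) ->.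
  exact: dvdn_mulr.
(* Both arcs are expanded in t, where y = t^(NM). The quotient [n %/ N] is exact wherever [b (q n)]
   is nonzero. *)
pose d z n := a (q n) - z ^+ (n %/ N) * b (q n).
suff [z zM zd] : exists2 z : R[i], z ^+ M = 1 & forall n, d z n = 0.
  have abq n : a (q n) = z ^+ (n %/ N) * b (q n) by apply/eqP; rewrite -subr_eq0; exact/eqP/zd.
  exists M, z; split=> // [p ap|k].
    have [k pk] := aL _ ap; apply: bL; apply: contra_neq ap.
    by rewrite pk -qN abq => ->; rewrite mulr0.
  by rewrite -qM abq mulKn.
apply: contrapT => no_z.
(* At t, the expansion of a and that of b conjugated by z approximate the same abscissa x to every
   order. *)
pose V z t := [/\ t <= 1 , z ^+ M = 1 & exists x,
  (forall L, `|x - \sum_(k < L) a (q (M * k)%N) * (t ^+ M) ^+ k| <= 2 * Ba / ra ^+ L * (t ^+ M) ^+ L) /\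
  (forall L, `|x - \sum_(k < L) z ^+ k * b (q (N * k)%N) * (t ^+ N) ^+ k| <= 2 * Bb / rb ^+ L * (t ^+ N) ^+ L)].
have [s sM] := unity_root_seq M0.
have [z _|e e0 eV] := @common_threshold s V.
  have [zM|zM] := eqVneq (z ^+ M) 1; last first.
    by exists 1 => // t _ _ [_ /eqP]; rewrite (negPf zM).
  apply: (@small_powerseries_neq0 _ (d z)); last first.
    apply: contrapT => /forallNP dz; apply: no_z; exists z => // n.
    by apply/eqP/negP => /negP; exact: dz.
  move=> L; pose g n := z ^+ (n %/ N) * b (q n).
  have g_dvd n : g n != 0 -> (N %| n)%N.
    by rewrite mulf_eq0 negb_or => /andP[_ /b_dvd].
  have Ea0 : 0 <= 2 * Ba / ra ^+ L by rewrite divr_ge0 ?mulr_ge0 ?exprn_ge0 // ltW.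
  have Eb0 : 0 <= 2 * Bb / rb ^+ L by rewrite divr_ge0 ?mulr_ge0 ?exprn_ge0 // ltW.
  exists (2 * Bb / rb ^+ L + \sum_(L <= n < N * L) `|g n| +
          (2 * Ba / ra ^+ L + \sum_(L <= n < M * L) `|a (q n)|)).
    by rewrite !addr_ge0 // sumr_ge0.
  move=> t t0 [t1 _ [x [xa xb]]].
  have t01 : 0 <= t <= 1 by rewrite ltW.
  have ha := approx_dilate M0 a_dvd Ea0 t01 (xa L).
  have hb : `|x - \sum_(n < L) g n * t ^+ n| <=
      (2 * Bb / rb ^+ L + \sum_(L <= n < N * L) `|g n|) * t ^+ L.
    apply: approx_dilate => //; apply: le_trans (xb L); rewrite le_eqVlt.
    by apply/orP/or_introl/eqP; congr (`|_ - _|); apply: eq_bigr => k _; rewrite /g mulKn.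
  have -> : \sum_(n < L) d z n * t ^+ n =
      x - \sum_(n < L) g n * t ^+ n - (x - \sum_(n < L) a (q n) * t ^+ n).
    rewrite opprB [RHS]addrC addrA subrK -sumrB.
    by apply: eq_bigr => n _; rewrite /d mulrBl.
  by rewrite (le_trans (ler_normB _ _)) // mulrDl lerD.
have germ_ab : curve_germ a (arc_image b).
  by rewrite ab; apply: (@filterE _ (nbhs ((0, 0) : R[i]^o * R[i]^o))).
have [c /= c0 cab] := (nbhs_ballP _ _).1 germ_ab.
(* The bounds control powers of t, the exclusion of every z, convergence of both series, and, with
   the last two, membership of (x, y) in the ball where the arcs coincide; |x| is at most (2 Ba /
   ra) t^M. *)
have [x|t t0 t_small] := @common_lower_bound
    [:: 1; e; ra / 2; rb / 2; c; c / (2 * Ba / ra + 1)].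
  have Ba1 : 0 < 2 * Ba / ra + 1.
    by apply: ltr_wpDl => //; rewrite divr_ge0 ?mulr_ge0 // ltW.
  by rewrite !inE => /or4P[|||/or3P[]] /eqP->; rewrite ?divr_gt0.
have {t_small} [t1 te tra trb [tc tBa]] : [/\ t < 1, t < e, t < ra / 2, t < rb / 2 &
    t < c /\ t < c / (2 * Ba / ra + 1)].
  by split; [..|split]; apply: t_small; rewrite !inE eqxx ?orbT.
have t_pow k : (0 < k)%N -> t ^+ k <= t.
  by case: k => // k _; rewrite exprS ler_piMr ?(ltW t0) // exprn_ile1 // ltW.
have norm_pow k : `|t ^+ k| = t ^+ k by rewrite ger0_norm // exprn_ge0 // ltW.
have small r : t < r / 2 -> forall k, (0 < k)%N -> 2 * t ^+ k <= r.
  move=> tr k k0; rewrite mulrC -ler_pdivlMr //.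
  exact: le_trans (t_pow k k0) (ltW tr).
have tMra : 2 * `|t ^+ M| <= ra by rewrite norm_pow small.
have [x ax arc_ax] := a_ex (t ^+ M) tMra.
have xc : `|x| < c.
  have := a_approx _ _ tMra ax 1%N; rewrite big_ord1 expr0 !mul0r mulr1 !expr1 norm_pow.
  have -> : a 0 = 0.
    by apply/eqP/negP => /negP/(F1_ge1 a1); rewrite ler10.
  rewrite subr0 => /le_lt_trans; apply.
  have Bra : 0 <= 2 * Ba / ra by rewrite divr_ge0 ?mulr_ge0 // ltW.
  move: tBa; rewrite ltr_pdivlMr ?ltr_wpDl //; apply: le_lt_trans.
  rewrite mulrC ler_pM ?exprn_ge0 ?(ltW t0) //; first exact: t_pow.
  by rewrite lerDl.
have arc_bx : arc_image b (x, t ^+ M ^+ N).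
  apply/cab => //; split; rewrite /ball /= sub0r normrN // -exprM norm_pow.
  by apply: le_lt_trans tc; rewrite t_pow // muln_gt0 M0.
have [M1 [s' [bM1 /= bx s'E]]] := arc_bx.
have M1E : M1 = M by exact: ramification_uniq bM1 bM.
rewrite {}M1E {M1 bM1} in bx s'E.
have tN0 : t ^+ N != 0 by rewrite expf_neq0 // gt_eqF.
(* [s'] is the parameter at which b passes through the point, and s'^M = y = t^(MN). *)
pose z := s' / t ^+ N.
have zM : z ^+ M = 1.
  by rewrite /z expr_div_n -s'E -!exprM mulnC divff // expf_neq0 // gt_eqF.
have s'z : s' = z * t ^+ N by rewrite /z divfK.
have norm_s' : `|s'| = t ^+ N.
  apply/eqP; rewrite -(eqrXn2 M0) ?exprn_ge0 ?(ltW t0) //.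
  by rewrite -normrX -s'E -!exprM norm_pow mulnC.
apply: (eV z t (sM _ zM) t0 te); split=> //; first exact: ltW.
exists x; split=> L.
  under eq_bigr do rewrite qN; rewrite -[in leRHS](norm_pow M).
  exact: a_approx.
under eq_bigr do rewrite qM mulrAC mulrC -exprMn -s'z; rewrite -norm_s'.
by apply: b_approx => //; rewrite norm_s' small.
Qed.

End Conjugates.

Section SupportInvariance.
Variable R : realType.
Implicit Types (a b : fseries R).

Lemma eq_ord a b : (forall q, (a q == 0) = (b q == 0)) -> ord a = ord b.
Proof.
move=> ab; rewrite /ord; congr (ereal_inf (_ @` _)).
by apply/seteqP; split=> q /= /eqP nz; apply/eqP; rewrite ?ab // -ab.
Qed.

Lemma eq_newton_polygon (G H : nat -> fseries R) :
  (forall i q, (G i q == 0) = (H i q == 0)) -> newton_polygon G = newton_polygon H.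
Proof.
move=> GH; rewrite /newton_polygon; congr (boundary (convex_hull _)).
by apply/seteqP; split=> p /= [i [q [u [v [/eqP nz u0 v0 ->]]]]];
  exists i, q, u, v; split=> //; apply/eqP; rewrite ?GH // -GH.
Qed.

End SupportInvariance.

(** * Invariance under conjugation of arcs *)

Section Twist.
Variables (R : realType) (M : nat) (z : R[i]).
Hypotheses (M_gt0 : (0 < M)%N) (zM : z ^+ M = 1).
Implicit Types (a b : fseries R).

(* The action on y^q, q in (1/M)N, of the conjugation y^(1/M) |-> z y^(1/M). *)
Definition twist_coef (q : rat) : R[i] := z ^+ `|numq (q * M%:R)|%N.

Definition twist a : fseries R := fun q => twist_coef q * a q.

Lemma twist_coef_lattice k : twist_coef (k%:R / M%:R) = z ^+ k.
Proof.
rewrite /twist_coef divfK ?pnatr_eq0 -?lt0n //.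
by rewrite -[k%:R]/(k%:Z%:~R) numq_int.
Qed.

Lemma twist_coef_neq0 q : twist_coef q != 0.
Proof.
rewrite expf_neq0 //; apply: contra_eq_neq zM => ->.
by rewrite expr0n gtn_eqF // eq_sym oner_neq0.
Qed.

Lemma twist_fmul a b : on_lattice M a -> on_lattice M b ->
  fmul (twist a) (twist b) = twist (fmul a b).
Proof.
move=> aM bM; apply/funext => q; rewrite /twist /fmul mulr_fsumr.
apply: eq_fsbigr => p _; rewrite mulrACA.
have [->|/aM[k pk]] := eqVneq (a p) 0; first by rewrite mul0r !mulr0.
have [->|/bM[l ql]] := eqVneq (b (q - p)) 0; first by rewrite !mulr0.
have qkl : q = (k + l)%:R / M%:R by rewrite natrD mulrDl -pk -ql addrC subrK.
by rewrite ql pk qkl !twist_coef_lattice exprD.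
Qed.

Lemma twist_fexp a n : on_lattice M a -> fexp (twist a) n = twist (fexp a n).
Proof.
move=> aM; elim: n => [|n IH].
  apply/funext => q; rewrite /twist /fexp /= /fone; case: (q =P 0) => [->|].
    by have := twist_coef_lattice 0; rewrite mul0r expr0 => ->; rewrite mul1r.
  by rewrite mulr0.
rewrite !fexpS IH twist_fmul //; exact: fexp_lattice.
Qed.

(** Integral powers y^j have lattice index M j, hence are fixed as z^M = 1; the conjugation
    therefore fixes the coefficients of g. *)
Lemma twist_translate g a i : on_lattice M a ->
  translate g (twist a) i = twist (translate g a i).
Proof.
move=> aM; apply/funext => q; rewrite /twist /translate mulr_fsumr.
apply: eq_fsbigr => -[k j] _ /=; rewrite -/(twist a) twist_fexp // /twist.
rewrite [RHS]mulrCA; congr (_ * _).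
have [->|/(fexp_lattice (k - i)%N aM)[l ql]] := eqVneq (fexp a (k - i) (q - j%:R)) 0.
  by rewrite !mulr0.
have qlj : q = (l + M * j)%:R / M%:R.
  by rewrite natrD mulrDl -ql (lat_mul M_gt0) subrK.
by rewrite {1}ql qlj !twist_coef_lattice exprD exprM zM expr1n mulr1.
Qed.

Lemma twist_eq0 a q : (twist a q == 0) = (a q == 0).
Proof. by rewrite mulf_eq0 (negPf (twist_coef_neq0 q)). Qed.

Lemma twist_subst g a : on_lattice M a -> subst g (twist a) = twist (subst g a).
Proof. by move=> aM; rewrite -!translate0 twist_translate. Qed.

Lemma polar_arc_twist f a : on_lattice M a -> F1 (twist a) ->
  polar_arc f a -> polar_arc f (twist a).
Proof.
move=> aM ta1 [_ fx0 [q /eqP fq]]; split=> // [p|].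
  by rewrite twist_subst // /twist fx0 mulr0.
by exists q; apply/eqP; rewrite twist_subst // twist_eq0.
Qed.

Lemma NP_hat_twist f a : on_lattice M a -> NP_hat f (twist a) = NP_hat f a.
Proof.
move=> aM; rewrite /NP_hat /NP /h.
rewrite (@eq_ord _ (subst f (twist a)) (subst f a)) => [|q]; last first.
  by rewrite twist_subst // twist_eq0.
by rewrite (@eq_newton_polygon _ _ (translate (dx f) a)) // => i q;
  rewrite twist_translate // twist_eq0.
Qed.

End Twist.

Lemma pos_ratE (d : rat) : 0 < d ->
  exists s D : nat, [/\ (0 < s)%N, (0 < D)%N & d = s%:R / D%:R].
Proof.
move=> d0; exists `|numq d|%N, `|denq d|%N; split.
- by rewrite absz_gt0 numq_eq0 gt_eqF.
- by rewrite absz_gt0 denq_neq0.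
- rewrite -[LHS]divq_num_den !natr_absz !gtr0_norm ?denq_gt0 //.
  by rewrite numq_gt0.
Qed.

Lemma curve_germ_twist (R : realType) (a b : fseries R) :
  F1 a -> F1 b -> curve_germ a = curve_germ b ->
  exists M z, [/\ (0 < M)%N, z ^+ M = 1, on_lattice M b & a = twist M z b].
Proof.
move=> a1 b1 /(curve_germ_conj a1 b1)[M [z [M0 zM aM bM ab]]].
exists M, z; split=> //; apply/funext => q.
have [[k ->]|noq] := pselect (exists k : nat, q = k%:R / M%:R).
  by rewrite ab /twist twist_coef_lattice.
have zero (c : fseries R) : on_lattice M c -> c q = 0.
  by move=> cM; apply/eqP/negP => /negP/cM.
by rewrite /twist (zero a) // (zero b) // mulr0.
Qed.

(** * Polar arcs in a gradient canyon *)

Section PolarArcs.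
Variables (R : realType) (K : nat).
Hypothesis K_gt0 : (0 < K)%N.
Implicit Types (f g : series2 R) (a b e : fseries R).

Lemma ord_grad_translate f a s (x : R) : (0 < s)%N -> positive_on_lattice K a ->
  grad_stable f a (s%:R / K%:R) -> (x%:E <= ord_grad f a)%E ->
  forall k p, translate (dx f) a k p != 0 -> x <= ratr (p + s%:R / K%:R * k%:R).
Proof.
move=> s0 aK [_ bad] xa k p nz; rewrite leNgt; apply/negP => px.
have [l pl] := translate_lattice K_gt0 (positive_on_latticeW aK) nz.
pose n := (l + s * k)%N; pose B := (n + k).+1.
have nE : n%:R / K%:R = p + s%:R / K%:R * k%:R.
  by rewrite natrD natrM mulrDl pl [in RHS]mulrAC.
(* Q(u) is the coefficient of y^(n/K) in f_x along a + u y^(s/K): the j-th power of the monomial has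
   index s j, hence n = l' + s j. Its coefficient of u^k is the given nonzero one. *)
pose Q : {poly R[i]} := \poly_(j < B)
  \sum_(l' < n.+1) translate (dx f) a j (l'%:R / K%:R) *+ (n == l' + s * j)%N.
have Q0 : Q != 0.
  apply: contraNneq nz => Q0; have := congr1 (fun P : {poly R[i]} => P`_k) Q0.
  rewrite coef0 coef_poly /B ltnS leq_addl.
  have ln : (l < n.+1)%N by rewrite ltnS leq_addr.
  rewrite (bigD1 (Ordinal ln)) //= eqxx mulr1n pl big1 ?addr0 => [->//|l'].
  by rewrite -val_eqE /= eqn_add2r eq_sym => /negPf->.
have [u Qu uok] := nonzero_poly_nonroot Q0 bad.
have xu : (x%:E <= ord (subst (dx f) (fadd a (fmono u (s%:R / K%:R)))))%E.
  move: uok => /contrapT uok.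
  by apply: le_trans xa _; rewrite -uok /ord_grad ge_min lexx.
move: px; rewrite ltNge => /negP; apply; apply: (ord_geP _ _).1 xu _ _.
apply: contra Qu => /eqP; rewrite -nE -translate0.
rewrite (@translate_add _ _ K_gt0 _ _ _ _ _ B) ?addn0 ?ltnS ?leq_addr //; last exact: fmono_lattice.
rewrite rootE horner_poly => QE; apply/eqP; rewrite -[RHS]QE.
apply: eq_bigr => j _; rewrite mulr_suml; apply: eq_bigr => l' _.
have sj : s%:R / K%:R * j%:R = (s * j)%:R / K%:R :> rat by rewrite natrM mulrAC.
rewrite bin0 mulr1n subn0 fexp_fmono /fmono sj.
have : (l' <= n)%N by rewrite -ltnS.
move: (nat_of_ord l') => {}l' l'n.
case: (n =P _) => [->|nl]; first by rewrite mulr1n addKn eqxx.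
rewrite mulr0n mul0r; case: (_ =P _) => [/(lat_inj K_gt0) nl'|]; last by rewrite mulr0.
by case: nl; rewrite -nl' subnKC.
Qed.

Lemma subst_ge_order f a m : has_order f m -> F1 a ->
  forall q, subst f a q != 0 -> m%:R <= q.
Proof.
move=> [fm _] a1 q; rewrite -translate0 => /translate_neq0[k [j [fkj _]]].
rewrite subn0 => /(fexp_ge (F1_ge1 a1)); rewrite mul1r lerBrDr -natrD.
apply: le_trans; rewrite ler_nat leqNgt; apply/negP => /fm/eqP.
by rewrite (negPf fkj).
Qed.

Lemma subst_dy_ge f a h0 : positive_on_lattice K a ->
  (forall q, subst (dx f) a q = 0) -> (forall q, subst f a q != 0 -> h0 <= q) ->
  forall q, subst (dy f) a q != 0 -> h0 - 1 <= q.
Proof.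
move=> aK fx0 h0_min q nz; have := nz; rewrite -translate0 => nz'.
have [n qn] := translate_lattice K_gt0 (positive_on_latticeW aK) nz'.
have := @subst_dy _ _ K_gt0 f a n aK fx0.
move=> E; have : subst f a ((n + K)%:R / K%:R) != 0.
  apply: contra_neq nz => z; move: E; rewrite z mulr0 -qn => /eqP.
  by rewrite mulf_eq0 pnatr_eq0 eqn0Ngt K_gt0 => /eqP.
move=> /h0_min; rewrite natrD mulrDl divff ?pnatr_eq0 -?lt0n // -qn; lra.
Qed.

Lemma ord_grad_polar f a h0 : positive_on_lattice K a ->
  (forall q, subst (dx f) a q = 0) -> (forall q, subst f a q != 0 -> h0 <= q) ->
  ((ratr (h0 - 1))%:E <= ord_grad f a)%E.
Proof.
move=> aK fx0 h0_min; rewrite /ord_grad le_min; apply/andP; split; apply/ord_geP => q.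
  by rewrite fx0 eqxx.
by move=> /(subst_dy_ge aK fx0 h0_min); rewrite ler_rat.
Qed.

(** Here the multiplicity is m + 1, and mini-regularity means [f m.+1 0 != 0]; only the monomial x^m
    of f_x contributes to X^m Y^0. *)
Lemma translate_dx_order f a m : has_order f m.+1 -> initial_form f m.+1 1 0 <> 0 ->
  positive_on_lattice K a -> translate (dx f) a m 0 != 0.
Proof.
move=> [fm _] init aK.
have fm0 : f m.+1 0%N != 0.
  apply/eqP => fm0; apply: init; rewrite /initial_form big_ord_recr /= subnn fm0 !mul0r addr0.
  by apply: big1 => i _; rewrite expr0n subn_eq0 leqNgt ltn_ord mulr0.
rewrite -[0](mul0r K%:R^-1) -[0]/(0%:R).
rewrite (@translate_coef _ _ K_gt0 _ _ _ _ m.+1 1 1) //.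
rewrite coef_sum big_ord_recr /= big1 ?add0r => [|k _]; last first.
  by rewrite big_ord1 bin_small ?mulr0 ?scale0r ?coef0 //.
rewrite big_ord1 binn mulr1 subnn expr0 muln0 mul1r coefZ coef1 mulr1.
by rewrite /dx mulf_neq0 // pnatr_eq0.
Qed.

(* By mini-regularity, f_x(a + u y^d) contains u^(m-1) y^(d (m-1)), hence
   m - 1 <= h(a) - 1 <= d (m - 1). *)
Lemma gradient_degree_ge1 f a s h0 : f 0%N 0%N = 0 -> mini_regular f ->
  polar_arc f a -> positive_on_lattice K a -> (0 < s)%N ->
  grad_stable f a (s%:R / K%:R) ->
  subst f a h0 != 0 -> (forall q, subst f a q != 0 -> h0 <= q) ->
  1 <= s%:R / K%:R :> rat /\
  (s%:R / K%:R = 1 :> rat -> exists2 m, has_order f m & h0 = m%:R).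
Proof.
move=> f00 [[|m] [fm init]] [a1 fx0 _] aK s0 st h0nz h0_min.
  by case: init; rewrite /initial_form big_ord1 subnn f00 !mul0r.
have mh := subst_ge_order fm a1 h0nz.
have tm := translate_dx_order fm init aK.
have m0 : (0 < m)%N.
  by rewrite lt0n; apply: contraNneq tm => ->; rewrite translate0 fx0.
have := ord_grad_translate s0 aK st (ord_grad_polar aK fx0 h0_min) tm.
rewrite ler_rat add0r => hm.
have mh' : m%:R <= h0 - 1 by rewrite lerBrDr natr1.
split=> [|s1]; first by rewrite -(@ler_pM2r _ m%:R) ?ltr0n // mul1r (le_trans mh').
exists m.+1 => //; apply/eqP; rewrite eq_le mh andbT.
by move: hm; rewrite s1 mul1r -natr1; lra.
Qed.

End PolarArcs.

(** * Corners of the Newton polygons *)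

Section Polygons.
Variables (R : realType) (K : nat).
Hypothesis K_gt0 : (0 < K)%N.
Implicit Types (f g : series2 R) (a b e : fseries R) (G : nat -> fseries R).

Definition quadrants G : set (R * R) :=
  [set p | exists (i : nat) (j : rat) (u v : R),
    [/\ G i j <> 0, 0 <= u, 0 <= v & p = (i%:R + u, ratr j + v)]].

Lemma quadrants_upset G : upset (quadrants G).
Proof.
move=> p u v [i [j [u' [v' [nz u'0 v'0 ->]]]]] u0 v0.
by exists i, j, (u' + u), (v' + v); split; rewrite ?addr_ge0 //= !addrA.
Qed.

Lemma quadrants_corner G i j : G i j != 0 -> quadrants G (i%:R, ratr j).
Proof. by move=> /eqP nz; exists i, j, 0, 0; rewrite !addr0. Qed.

Lemma lattice_ge0 a q : on_lattice K a -> a q != 0 -> 0 <= q.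
Proof. by move=> aK /aK[n ->]; rewrite divr_ge0. Qed.

Lemma quadrants_hull_ge0 G : (forall i, on_lattice K (G i)) ->
  forall p, convex_hull (quadrants G) p -> 0 <= p.1 /\ 0 <= p.2.
Proof.
move=> GK; apply: convex_hull_min => [|_ [i [j [u [v [/eqP nz u0 v0 ->]]]]]] /=.
  apply/convex_setP => x y t /andP[t0 t1] /= [x1 x2] [y1 y2].
  by rewrite !addr_ge0 ?mulr_ge0 ?subr_ge0.
by rewrite !addr_ge0 // ler0q (lattice_ge0 (GK i) nz).
Qed.

(* If G m has a nonzero constant term, the corners of the rows i <= m
   dominate all the others. *)
Lemma quadrants_hull_closed G m : (forall i, on_lattice K (G i)) -> G m 0 != 0 ->
  closed (convex_hull (quadrants G)).
Proof.
move=> GK Gm.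
have ex i : exists p, quadrants G p /\
    forall j, G i j != 0 -> p.1 <= i%:R /\ p.2 <= ratr j.
  have [[j Gij]|/forallNP Gi] := pselect (exists j, G i j != 0).
    have [q Gq qmin] := lattice_min K_gt0 (GK i) Gij.
    exists (i%:R, ratr q); split; first exact: quadrants_corner.
    by move=> r /qmin; rewrite /= ler_rat.
  (* An empty row receives the corner of row m as a harmless filler. *)
  by exists (m%:R, ratr 0); split; [exact: quadrants_corner|move=> j /Gi].
have [p pP] := choice ex.
apply: (@convex_hull_closed _ m.+1 (fun i => p i)) => //.
- exact: quadrants_upset.
- by move=> i; have [] := pP i.
move=> _ [i [j [u [v [/eqP nz u0 v0 ->]]]]] /=.
case: (ltnP i m.+1) => im.
  exists (Ordinal im); have [_ /(_ _ nz)[p1 p2]] := pP i.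
  by split=> /=; [apply: le_trans p1 _|apply: le_trans p2 _]; rewrite lerDl.
exists ord_max; have [_ /(_ _ Gm)[p1 p2]] := pP m; split=> /=.
  by rewrite (le_trans p1) // -[leLHS]addr0 lerD // ler_nat ltnW.
rewrite (le_trans p2) // -[leLHS]addr0 lerD // ler_rat.
exact: lattice_ge0 (GK i) nz.
Qed.

Lemma convex_hull_newton_polygonU G m z : (forall i, on_lattice K (G i)) -> G m 0 != 0 ->
  convex_hull (newton_polygon G `|` [set z]) = convex_hull (quadrants G `|` [set z]).
Proof.
move=> GK Gm; rewrite /newton_polygon -/(quadrants G).
rewrite (@convex_hull_boundaryU _ _ (0, 0) _ (@convex_hull_convex _ _) (quadrants_hull_closed GK Gm)
  (quadrants_hull_ge0 GK)).
exact: convex_hullU.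
Qed.

(* With z = (0, w), the point (i, p + r) lies above the segment from z to (k, p)
   because w <= p + d k and d (k - i) <= r. *)
Lemma quadrants_translate_sub g a e d w : 0 <= d ->
  positive_on_lattice K a -> positive_on_lattice K e ->
  (forall q, e q != 0 -> d <= q) ->
  (forall k p, translate g a k p != 0 -> w <= p + d * k%:R) ->
  (forall q, subst g (fadd a e) q = 0) ->
  quadrants (translate g (fadd a e)) `<=`
    convex_hull (quadrants (translate g a) `|` [set (0, ratr w)]).
Proof.
move=> d0 aK eK ed aw ge0 _ [i [j [u [v [/eqP nz u0 v0 ->]]]]].
have [k [p [r [ik ap er jE]]]] := translate_add_neq0 K_gt0 aK eK nz.
have i0 : (0 < i)%N.
  by rewrite lt0n; apply: contraNneq nz => ->; rewrite translate0 ge0.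
have /(congr1 (@ratr R)) rE := jE.
have : @ratr R w <= ratr p + ratr d * k%:R.
  by rewrite -(ratr_nat _ k) -rmorphM -rmorphD ler_rat; exact: aw.
have : ratr d * (k%:R - i%:R) <= @ratr R r.
  rewrite -natrB // -(ratr_nat _ (k - i)) -rmorphM ler_rat.
  exact: fexp_ge ed _ _ er.
have : 0 <= @ratr R d by rewrite ler0q.
move: rE; rewrite rmorphD /= => ->.
have iR : 0 < i%:R :> R by rewrite ltr0n.
have ikR : i%:R <= k%:R :> R by rewrite ler_nat.
set W := ratr w; set P := ratr p; set D := ratr d; set S := ratr r.
move=> D0 DS WP.
(* The target has abscissa i + u, so the corner is moved right by the same u. The ratio l then stays
   at most 1, and (1 - l)(k + u) = k - i. *)
have kuP : quadrants (translate g a) (k%:R + u, P).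
  by exists k, p, u, 0; rewrite addr0; split=> //; exact/eqP.
apply: (convex_hull_segment (@quadrants_upset _) kuP); [lra|lra|].
have ku0 : 0 < k%:R + u :> R by lra.
set l := (i%:R + u) / (k%:R + u).
have lE : (1 - l) * (k%:R + u) = k%:R - i%:R by rewrite /l; field; rewrite gt_eqF.
have l1 : 0 <= 1 - l.
  by rewrite subr_ge0 /l ler_pdivrMr // mul1r; lra.
have h1 : (1 - l) * (W - P) <= (1 - l) * (D * k%:R) by apply: ler_wpM2l => //; lra.
have h2 : D * ((1 - l) * k%:R) <= D * (k%:R - i%:R).
  by apply: ler_wpM2l => //; rewrite -lE mulrDr lerDl mulr_ge0.
have h3 : (1 - l) * (D * k%:R) = D * ((1 - l) * k%:R) by ring.
have h4 : (1 - l) * W + l * P = P + (1 - l) * (W - P) by ring.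
rewrite h4; lra.
Qed.

End Polygons.

(** * Comparison of two polar arcs agreeing below the degree *)

Section Canyon.
Variables (R : realType) (K : nat).
Hypothesis K_gt0 : (0 < K)%N.
Implicit Types (f g : series2 R) (a b e : fseries R).

Lemma ord_min a q0 : a q0 != 0 -> (forall q, a q != 0 -> q0 <= q) ->
  ord a = (ratr q0)%:E.
Proof.
move=> aq0 q0_min; apply/eqP; rewrite eq_le; apply/andP; split.
  by apply: ereal_inf_lbound; exists q0 => //; exact/eqP.
by apply/ord_geP => q /q0_min; rewrite ler_rat.
Qed.

(** The Taylor term of degree k + 1 in e has order at least (h0 - 1 - d k) + d (k + 1) = h0 - 1 + d,
    which exceeds h0 because d > 1. *)
Lemma subst_add_higher f a e d h0 : 1 < d -> positive_on_lattice K a ->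
  positive_on_lattice K e -> (forall q, e q != 0 -> d <= q) ->
  (forall k p, translate (dx f) a k p != 0 -> h0 - 1 <= p + d * k%:R) ->
  forall q, q <= h0 -> subst f (fadd a e) q = subst f a q.
Proof.
move=> d1 aK eK ed aw q qh0.
have [[n qn]|noq] := pselect (exists n : nat, q = n%:R / K%:R); last first.
  have z b : positive_on_lattice K b -> subst f b q = 0.
    move=> bK; apply/eqP/negP => /negP; rewrite -translate0.
    by move/(translate_lattice K_gt0 (positive_on_latticeW bK)).
  by rewrite !z //; exact: positive_on_lattice_add.
rewrite -!translate0 qn (@translate_add _ _ K_gt0 _ _ _ _ _ n.+1) ?addn0 //.
have K0 : K%:R != 0 :> rat by rewrite pnatr_eq0 -lt0n.
rewrite big_ord_recl /= big_ord_recr /= !big1 ?addr0 ?add0r.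
- by rewrite subnn mul0r /fexp /= /fone eqxx mulr1 bin0 mulr1n.
- move=> k _; apply: big1 => l _; rewrite /bump leq0n add1n.
  apply/eqP/negP => /negP; rewrite mulrn_eq0 negb_or mulf_eq0 negb_or.
  move=> /andP[_ /andP[ak ek]].
  have ln : (l <= n)%N by rewrite -ltnS.
  have := @fexp_ge _ _ _ ed k.+1 _ ek; rewrite -natr1 mulrDr mulr1.
  rewrite natrB // mulrBl -qn => er.
  have := aw k (l%:R / K%:R); rewrite (translate_dx K_gt0) // mulf_neq0 ?pnatr_eq0 // => /(_ isT).
  lra.
- move=> l _; rewrite /fexp /= /fone mulf_eq0 invr_eq0 (negPf K0) orbF pnatr_eq0.
  by rewrite subn_eq0 leqNgt ltn_ord mulr0 mul0rn.
Qed.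

Lemma NP_hat_canyon f a b s : let d := s%:R / K%:R in
  f 0%N 0%N = 0 -> mini_regular f -> polar_arc f a -> polar_arc f b ->
  positive_on_lattice K a -> positive_on_lattice K b -> (0 < s)%N ->
  grad_stable f a d -> (d = 1 -> grad_stable f b d) ->
  (forall q, q < d -> a q = b q) -> NP_hat f a = NP_hat f b.
Proof.
move=> d f00 freg pa pb aK bK s0 sta stb ab.
have [_ fxa [qa /eqP fqa]] := pa; have [_ fxb [qb /eqP fqb]] := pb.
have subst_lat c : positive_on_lattice K c -> on_lattice K (subst f c).
  by move=> cK; rewrite -translate0; exact/translate_lattice/positive_on_latticeW.
have [ha fha ha_min] := lattice_min K_gt0 (subst_lat a aK) fqa.
have [hb fhb hb_min] := lattice_min K_gt0 (subst_lat b bK) fqb.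
have [d1 da1] := gradient_degree_ge1 K_gt0 f00 freg pa aK s0 sta fha ha_min.
have d0 : 0 <= d by rewrite (le_trans _ d1).
have aw k p : translate (dx f) a k p != 0 -> ha - 1 <= p + d * k%:R.
  move=> /(ord_grad_translate K_gt0 s0 aK sta (ord_grad_polar K_gt0 aK fxa ha_min)).
  by rewrite ler_rat.
pose e : fseries R := fun q => b q - a q.
pose e' : fseries R := fun q => a q - b q.
have bE : b = fadd a e by apply/funext => q; rewrite /fadd addrC subrK.
have aE : a = fadd b e' by apply/funext => q; rewrite /fadd addrC subrK.
have eK : positive_on_lattice K e.
  move=> q; rewrite /e; have [->|/aK //] := eqVneq (a q) 0; rewrite subr0; exact: bK.
have e'K : positive_on_lattice K e'.
  move=> q; rewrite /e'; have [->|/bK //] := eqVneq (b q) 0; rewrite subr0; exact: aK.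
have ed q : e q != 0 -> d <= q.
  by rewrite leNgt; apply: contraNN => /ab; rewrite /e => ->; rewrite subrr.
have e'd q : e' q != 0 -> d <= q.
  by rewrite leNgt; apply: contraNN => /ab; rewrite /e' => ->; rewrite subrr.
have hab : hb = ha.
  (* At d = 1 a Taylor term of order exactly [ha] could cancel the leading one, so both orders are
     identified with the multiplicity of f. *)
  have [dE|d_neq1] := eqVneq d 1.
    have [_ /(_ dE) [m fm ->]] := gradient_degree_ge1 K_gt0 f00 freg pb bK s0 (stb dE) fhb hb_min.
    have [m' fm' ->] := da1 dE.
    have order_le n n' : has_order f n -> has_order f n' -> (n' <= n)%N.
      by move=> [_ [i [j [<- nz]]]] [z _]; rewrite leqNgt; apply/negP => /z.
    have -> : m = m' by apply/eqP; rewrite eqn_leq (order_le m') ?(order_le m).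
    by [].
  have d_gt1 : 1 < d by rewrite lt_neqAle eq_sym d_neq1.
  have same := subst_add_higher d_gt1 aK eK ed aw.
  apply/eqP; rewrite eq_le hb_min; last by rewrite bE same.
  have [//|lt_hb] := leP ha hb.
  by move: fhb; rewrite bE same ?ltW // => /ha_min; rewrite leNgt lt_hb.
(* A term from row k' carries e^(k' - k), of order at least d (k' - k), which compensates exactly
   for the change of row in [aw]. *)
have bw k p : translate (dx f) b k p != 0 -> ha - 1 <= p + d * k%:R.
  rewrite bE => /(translate_add_neq0 K_gt0 aK eK)[k' [p' [r [kk' /aw ap er ->]]]].
  have := fexp_ge ed er; rewrite natrB // mulrBr; lra.
have [m [fm init]] := freg.
have [m' mE] : exists m', m = m'.+1.
  case: m fm init => [|m'] _; last by exists m'.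
  by case; rewrite /initial_form big_ord1 subnn f00 !mul0r.
rewrite {}mE in fm init.
have lat c i : positive_on_lattice K c -> on_lattice K (translate (dx f) c i).
  by move=> cK; exact/translate_lattice/positive_on_latticeW.
have hullE c (cK : positive_on_lattice K c) z :=
  convex_hull_newton_polygonU K_gt0 z (fun i => lat c i cK) (translate_dx_order K_gt0 fm init cK).
rewrite /NP_hat /NP !hullE // /h (ord_min fha ha_min) (ord_min fhb hb_min) hab /=.
rewrite -(rmorph1 ratr) -rmorphB.
apply/seteqP; split; apply: convex_hull_min; try exact: convex_hull_convex.
  move=> p [|->]; last by apply: sub_convex_hull; right.
  rewrite aE; apply: (quadrants_translate_sub K_gt0) d0 bK e'K e'd bw _ p.
  by rewrite -aE.
move=> p [|->]; last by apply: sub_convex_hull; right.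
rewrite bE; apply: (quadrants_translate_sub K_gt0) d0 aK eK ed aw _ p.
by rewrite -bE.
Qed.

End Canyon.

Theorem lemma4p2 (R : realType) (f : series2 R) (gamma : fseries R)
    (C : set (set_germ R)) (d : rat)
    (f_holo : holomorphic_germ f) (f_reg : mini_regular f)
    (gamma_polar : polar_arc f gamma)
    (C_canyon : C = gradient_canyon f gamma)
    (gamma_degree : gradient_degree f gamma d)
    (C_degree : d = 1 -> common_degree f C d) :
  (forall gamma1 gamma2 : fseries R,
     polar_arc f gamma1 -> contained_in gamma1 C ->
     polar_arc f gamma2 -> contained_in gamma2 C ->
     NP_hat f gamma1 = NP_hat f gamma2) /\
  (exists P : set (R * R), forall g : fseries R,
     polar_arc f g -> contained_in g C -> NP_hat f g = P).
Proof.
suff NPC g : polar_arc f g -> contained_in g C -> NP_hat f g = NP_hat f gamma.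
  split; last by exists (NP_hat f gamma).
  by move=> g1 g2 p1 c1 p2 c2; rewrite NPC // [RHS]NPC.
(* Membership only provides an arc [a] with the germ of g and the prescribed terms up to its degree
   d'; g itself is a conjugate of [a]. *)
move=> g_polar; rewrite C_canyon => -[a [u [d' [deg' a1 a_gamma /esym ag]]]].
have d'E : d' = d.
  apply/eqP; rewrite eq_le; apply/andP; split.
    by case: deg' => _; apply; case: gamma_degree.
  by case: gamma_degree => _; apply; case: deg'.
rewrite {}d'E {d'} in deg' a_gamma.
have [g1 _ _] := g_polar; have [gamma1 _ _] := gamma_polar.
have [M [z [M0 zM gM aE]]] := curve_germ_twist a1 g1 ag.
have a_polar : polar_arc f a by rewrite aE; apply: polar_arc_twist => //; rewrite -aE.
rewrite -(NP_hat_twist M0 zM f gM) -aE; apply/esym.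
have [N1 [N1_gt0 aN1 _]] := ramification_exists a1.
have [N2 [N2_gt0 gN2 _]] := ramification_exists gamma1.
have [stable _] := gamma_degree; have [d0 _] := stable.
have [s [D [s0 D0 dE]]] := pos_ratE d0.
have K0 : (0 < N1 * N2 * D)%N by rewrite !muln_gt0 N1_gt0 N2_gt0.
(* One denominator for the exponents of [a], those of [gamma] and d. *)
have dK : d = (s * (N1 * N2))%:R / (N1 * N2 * D)%:R.
  rewrite dE !natrM; field.
  by rewrite !pnatr_eq0 -!lt0n N1_gt0 N2_gt0 D0.
apply: (@NP_hat_canyon _ (N1 * N2 * D) K0 _ _ _ (s * (N1 * N2))) => //.
- by case: f_holo.
- apply: lattice_dilate => //; rewrite mulnC; apply: lattice_dilate => //.
  exact: supported_in_lattice.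
- apply: lattice_dilate => //; apply: lattice_dilate => //.
  exact: supported_in_lattice.
- by rewrite !muln_gt0 s0 N1_gt0.
- by rewrite -dK.
(* [a] is polar, being conjugate to g, and its germ lies in C, so the common degree applies to
   it. *)
- rewrite -dK => d1; have [] // : gradient_degree f a d.
  by apply: C_degree => //; rewrite C_canyon; exists a, u, d.
- move=> q; rewrite -dK => qd; rewrite (a_gamma _ (ltW qd)) /fadd /fmono.
  by rewrite (lt_eqF qd) addr0.
Qed.
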